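(* Let $n \geq 1$ be an integer, let $G = GL(n,\mathbb{R})$, and let $\mathcal{N}_0 = \{ N(x \mid 0,\Sigma) \mid \Sigma \in \mathrm{Sym}^+(n,\mathbb{R})\}$ be the manifold of zero-mean $n$-variate normal distributions, with the $G$-action $h.N(x\mid 0,\Sigma) = N(x \mid 0, h\Sigma h^{\mathsf{T}})$. Let $g^F$ be the Fisher metric on $\mathcal{N}_0$ and, for $\alpha \in \mathbb{R}$, let $C^{A(\alpha)}$ be the Amari--Chentsov $\alpha$-tensor field on $\mathcal{N}_0$. Define the real vector space $$S^3(T^\ast \mathcal{N}_0)^{G} := \{ C \in S^3(T^\ast \mathcal{N}_0) \mid C \text{ is } G\text{-invariant} \}$$ and its linear subspace $$S^3(T^\ast \mathcal{N}_0)^{G}_{g^F\text{-}\mathrm{CS}} := \{ C \in S^3(T^\ast \mathcal{N}_0)_{g^F\text{-}\mathrm{CS}} \mid C \text{ is } G\text{-invariant} \}.$$ Then the following hold: (1) Any $G$-invariant statistical structure $(g,C)$ on $\mathcal{N}_0$ is conjugate symmetric. In particular, $S^3(T^\ast \mathcal{N}_0)^{G}_{g^F\text{-}\mathrm{CS}} = S^3(T^\ast \mathcal{N}_0)^{G}$. (2) There exists a linear isomorphism $\Phi$ from $S^3(T^\ast \mathcal{N}_0)^{G}$ onto the space $\mathcal{SP}_n^3$ of all homogeneous cubic symmetric polynomials in $n$ variables $x_1,\dots,x_n$ over $\mathbb{R}$ such that $$\Phi(C^{A(\alpha)}) = \alpha (x_1^3 + \dots + x_n^3) \quad \text{for all }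 \alpha \in \mathbb{R}.$$ (3) The dimension of $S^3(T^\ast \mathcal{N}_0)^{G}_{g^F\text{-}\mathrm{CS}}$ is $$\dim S^3(T^\ast \mathcal{N}_0)^{G}_{g^F\text{-}\mathrm{CS}} = \begin{cases} 3 & \text{if } n \geq 3, \\ 2 & \text{if } n = 2, \\ 1 & \text{if } n = 1. \end{cases}$$
   Context: $\mathrm{Sym}(n,\mathbb{R})$ is the vector space of real symmetric $n\times n$ matrices and $\mathrm{Sym}^+(n,\mathbb{R})$ is its open subset of positive definite matrices. $N(x\mid\mu,\Sigma)$ denotes the $n$-variate normal distribution on $\mathbb{R}^n$ with mean vector $\mu$ and variance-covariance matrix $\Sigma$. The manifold $\mathcal{N}_0$ is identified with $\mathrm{Sym}^+(n,\mathbb{R})$ via $N(x\mid 0,\Sigma)\mapsto\Sigma$; under this identification $G=GL(n,\mathbb{R})$ acts by $h.\Sigma = h\Sigma h^{\mathsf{T}}$, and each tangent space $T_\Sigma\mathcal{N}_0$ is identified with $\mathrm{Sym}(n,\mathbb{R})$ in the standard way ($A \mapsto \frac{d}{dt}|_{t=0}(\Sigma+tA)$). For a smooth manifold $M$, $S^3(T^\ast M)$ denotes the space of smooth symmetric $(0,3)$-tensor fields on $M$. A statistical structure on $M$ is a pair $(g,C)$ of a Riemannian metric $g$ on $M$ and a $C \in S^3(T^\ast M)$. It is called conjugate symmetric if the $(0,4)$-tensor field $\nabla^g C$ is symmetric (in all four arguments), where $\nabla^g$ is the Levi-Civita connection of $g$. For a Riemannian manifold $(M,g)$, $S^3(T^\ast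 M)_{g\text{-}\mathrm{CS}}$ denotes the linear subspace of all $C \in S^3(T^\ast M)$ such that $(g,C)$ is conjugate symmetric. If a Lie group $G$ acts smoothly on $M$, a tensor field on $M$ is $G$-invariant if it is preserved by the diffeomorphism of $M$ induced by every element of $G$; a statistical structure $(g,C)$ is $G$-invariant if both $g$ and $C$ are $G$-invariant. With $\ell(x;\Sigma)$ the log-density of $N(x\mid 0,\Sigma)$, the Fisher metric is $g^F_\Sigma(X,Y) = E_\Sigma[(X\ell)(Y\ell)]$ and the Amari--Chentsov $\alpha$-tensor field is $C^{A(\alpha)}_\Sigma(X,Y,Z) = \alpha\,E_\Sigma[(X\ell)(Y\ell)(Z\ell)]$, where $E_\Sigma$ is expectation under $N(x\mid 0,\Sigma)$ and $X\ell$ is the derivative of $\ell$ in the parameter direction $X$. Both $g^F$ and $C^{A(\alpha)}$ are $GL(n,\mathbb{R})$-invariant, and at the identity matrix $I_n$ they are given, for $X,Y,Z\in\mathrm{Sym}(n,\mathbb{R})$, by $$g^F_{I_n}(X,Y) = \tfrac12 \operatorname{tr}(XY), \qquad C^{A(\alpha)}_{I_n}(X,Y,Z) = \alpha\operatorname{tr}(XYZ).$$ $\mathcal{SP}_n^3$ consists of the polynomials in $\mathbb{R}[x_1,\dots,x_n]$ that are homogeneous of degree $3$ (including $0$) and invariant under all permutations of the variables. *)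

(* Defs.v *)
From HB Require Import structures.
From mathcomp Require Import all_boot all_order all_algebra.
From mathcomp Require Import all_classical all_reals all_analysis.
(* The notations of [mpoly] clash with those imported above: names are used
   qualified, with [mpolyX R (mnm1 i)] for the i-th variable. *)
From mathcomp Require Import (canonicals, coercions) mpoly.

Set Implicit Arguments.
Unset Strict Implicit.
Unset Printing Implicit Defensive.

Import Order.TTheory GRing.Theory Num.Theory.
Import numFieldNormedType.Exports.

Local Open Scope classical_set_scope.
Local Open Scope ring_scope.

Section LinearAlgebra.
Context {K : fieldType} {V W : lmodType K}.

Definition has_dimension (A : set V) (d : nat) : Prop :=
  exists e : 'I_d -> V,
    (forall c : 'I_d -> K, \sum_i c i *: e i = 0 -> forall i, c i = 0) /\
    A = [set v | exists c : 'I_d -> K, v = \sum_i c i *: e i].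

Definition linear_isomorphism (A : set V) (B : set W) (f : V -> W) : Prop :=
  (forall (a : K) u v, A u -> A v -> f (a *: u + v) = a *: f u + f v) /\
  set_bij A B f.

End LinearAlgebra.

(* [U] is an open subset of a finite-dimensional real vector space [V].  Every
   tangent space is identified with [V]; functions and fields on [U] are total
   functions on [V], only their values on [U] being relevant. *)
Section OpenSubset.
Context {R : realType}.

(* In finite dimension, [C_on k U f] is the usual notion of class C^k. *)
Fixpoint C_on {V W : normedModType R} (k : nat) (U : set V) (f : V -> W)
    : Prop :=
  if k is k'.+1 then
    (forall p, U p -> differentiable f p) /\
    (forall v : V, C_on k' U ('D_v f))
  else forall p, U p -> {for p, continuous f}.

Definition smooth_on {V W : normedModType R} (U : set V) (f : V -> W) : Prop :=
  forall k, C_on k U f.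

Context {V : normedModType R} (U : set V).

Definition lie_bracket (X Y : V -> V) : V -> V :=
  fun p => 'D_(X p) Y p - 'D_(Y p) X p.

Definition affine_connection (nabla : (V -> V) -> (V -> V) -> V -> V) : Prop :=
  [/\ forall X Y, smooth_on U X -> smooth_on U Y -> smooth_on U (nabla X Y),
      forall (f : V -> R) X X' Y, smooth_on U f ->
        smooth_on U X -> smooth_on U X' -> smooth_on U Y ->
        forall p, U p -> nabla (fun q => f q *: X q + X' q) Y p =
                         f p *: nabla X Y p + nabla X' Y p,
      forall X Y Y',
        smooth_on U X -> smooth_on U Y -> smooth_on U Y' ->
        forall p, U p -> nabla X (fun q => Y q + Y' q) p =
                         nabla X Y p + nabla X Y' p
    & forall (f : V -> R) X Y, smooth_on U f ->
        smooth_on U X -> smooth_on U Y ->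
        forall p, U p -> nabla X (fun q => f q *: Y q) p =
                         'D_(X p) f p *: Y p + f p *: nabla X Y p].

Definition torsion_free (nabla : (V -> V) -> (V -> V) -> V -> V) : Prop :=
  forall X Y, smooth_on U X -> smooth_on U Y ->
  forall p, U p -> nabla X Y p - nabla Y X p = lie_bracket X Y p.

Definition metric_compatible (g : V -> V -> V -> R)
    (nabla : (V -> V) -> (V -> V) -> V -> V) : Prop :=
  forall X Y Z, smooth_on U X -> smooth_on U Y -> smooth_on U Z ->
  forall p, U p ->
    'D_(X p) (fun q => g q (Y q) (Z q)) p =
    g p (nabla X Y p) (Z p) + g p (Y p) (nabla X Z p).

Definition levi_civita (g : V -> V -> V -> R)
    (nabla : (V -> V) -> (V -> V) -> V -> V) : Prop :=
  [/\ affine_connection nabla, torsion_free nabla & metric_compatible g nabla].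

Definition riemannian_metric (g : V -> V -> V -> R) : Prop :=
  [/\ forall p, U p -> forall Y, scalar (fun X => g p X Y),
      forall p, U p -> forall X Y, g p X Y = g p Y X,
      forall p, U p -> forall X, X != 0 -> 0 < g p X X
    & forall X Y, smooth_on U (fun p => g p X Y)].

(* Tensor fields on [U] are extended by 0 outside [U], so that equality in [S3]
   is equality of tensor fields on [U]; this matters for dimensions. *)
Definition S3 : set (V -> V -> V -> V -> R) :=
  [set C : V -> V -> V -> V -> R |
   [/\ forall p, ~ U p -> C p = 0,
      forall p, U p -> forall Y Z, scalar (fun X => C p X Y Z),
      forall p, U p -> forall X Y Z, C p X Y Z = C p Y X Z,
      forall p, U p -> forall X Y Z, C p X Y Z = C p X Z Y
    & forall X Y Z, smooth_on U (fun p => C p X Y Z)]].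

Definition statistical_structure (g : V -> V -> V -> R)
    (C : V -> V -> V -> V -> R) : Prop :=
  riemannian_metric g /\ S3 C.

Definition covariant_derivative (nabla : (V -> V) -> (V -> V) -> V -> V)
    (C : V -> V -> V -> V -> R) (W X Y Z : V -> V) : V -> R :=
  fun p => 'D_(W p) (fun q => C q (X q) (Y q) (Z q)) p
           - C p (nabla W X p) (Y p) (Z p)
           - C p (X p) (nabla W Y p) (Z p)
           - C p (X p) (Y p) (nabla W Z p).

(* Symmetry under the three adjacent transpositions of the arguments, which
   generate the symmetric group. *)
Definition symmetric4 (T : (V -> V) -> (V -> V) -> (V -> V) -> (V -> V) ->
    V -> R) : Prop :=
  forall W X Y Z,
  smooth_on U W -> smooth_on U X -> smooth_on U Y -> smooth_on U Z ->
  forall p, U p ->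
  [/\ T W X Y Z p = T X W Y Z p,
      T W X Y Z p = T W Y X Z p
    & T W X Y Z p = T W X Z Y p].

(* For a Riemannian metric [g], the Levi-Civita connection exists and is unique
   as an operator on the smooth vector fields on [U]. *)
Definition conjugate_symmetric (g : V -> V -> V -> R)
    (C : V -> V -> V -> V -> R) : Prop :=
  exists2 nabla, levi_civita g nabla & symmetric4 (covariant_derivative nabla C).

Definition S3_CS (g : V -> V -> V -> R) : set (V -> V -> V -> V -> R) :=
  [set C : V -> V -> V -> V -> R |
    statistical_structure g C /\ conjugate_symmetric g C].

Definition preserves2 (phi : V -> V) (g : V -> V -> V -> R) : Prop :=
  forall p, U p -> forall X Y,
    g (phi p) ('d phi p X) ('d phi p Y) = g p X Y.

Definition preserves3 (phi : V -> V) (C : V -> V -> V -> V -> R) : Prop :=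
  forall p, U p -> forall X Y Z,
    C (phi p) ('d phi p X) ('d phi p Y) ('d phi p Z) = C p X Y Z.

End OpenSubset.

Section SymmetricMatrices.
Context (R : realType) (n : nat).

Definition is_sym : {pred 'M[R]_n} := [pred A : 'M[R]_n | A^T == A].

Fact is_sym_submod_closed : submod_closed is_sym.
Proof.
split=> [|a A B]; rewrite !inE ?trmx0// => /eqP AA /eqP BB.
by rewrite linearP/= AA BB.
Qed.

HB.instance Definition _ :=
  GRing.isSubmodClosed.Build R 'M[R]_n is_sym is_sym_submod_closed.

Record Sym := MkSym { sym_val :> 'M[R]_n ; _ : sym_val \in is_sym }.

HB.instance Definition _ := [isSub for sym_val].
HB.instance Definition _ := [Choice of Sym by <:].
HB.instance Definition _ := [SubChoice_isSubLmodule of Sym by <:].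

Fact sym_norm_triangle (A B : Sym) :
  `|val (A + B)| <= `|val A| + `|val B|.
Proof. by rewrite raddfD ler_normD. Qed.

Fact sym_norm_scale (a : R) (A : Sym) : `|val (a *: A)| = `|a| * `|val A|.
Proof. by rewrite linearZ normrZ. Qed.

Fact sym_norm_eq0 (A : Sym) : `|val A| = 0 -> A = 0.
Proof. by move=> /normr0_eq0 A0; apply: val_inj; rewrite A0 raddf0. Qed.

HB.instance Definition _ := Lmodule_isNormed.Build R Sym
  sym_norm_triangle sym_norm_scale sym_norm_eq0.

(* Typeclass resolution unfolds [nbhs S] and then needs these instances. *)
#[global] Instance sym_nbhs_filter (S : Sym) : Filter (nbhs S).
Proof. exact: (nbhs_filter S). Qed.

#[global] Instance sym_nbhs_pfilter (S : Sym) : ProperFilter (nbhs S).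
Proof. exact: (nbhs_pfilter S). Qed.

Definition SymPos : set Sym :=
  [set S | forall x : 'cV[R]_n, x != 0 -> 0 < (x^T *m S *m x) 0 0].

Fact congr_is_sym (h : 'M[R]_n) (S : Sym) : h *m S *m h^T \in is_sym.
Proof.
by case: S => S /= /eqP SS; rewrite inE !trmx_mul trmxK SS mulmxA.
Qed.

Definition act (h : 'M[R]_n) (S : Sym) : Sym := MkSym (congr_is_sym h S).

Definition G_invariant2 (g : Sym -> Sym -> Sym -> R) : Prop :=
  forall h : 'M[R]_n, h \in unitmx -> preserves2 SymPos (act h) g.

Definition G_invariant3 (C : Sym -> Sym -> Sym -> Sym -> R) : Prop :=
  forall h : 'M[R]_n, h \in unitmx -> preserves3 SymPos (act h) C.

Definition S3_G : set (Sym -> Sym -> Sym -> Sym -> R) :=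
  [set C : Sym -> Sym -> Sym -> Sym -> R | S3 SymPos C /\ G_invariant3 C].

Definition S3_CS_G (g : Sym -> Sym -> Sym -> R) :
    set (Sym -> Sym -> Sym -> Sym -> R) :=
  [set C : Sym -> Sym -> Sym -> Sym -> R |
    S3_CS SymPos g C /\ G_invariant3 C].

End SymmetricMatrices.

Section LebesgueRn.
Context {R : realType}.
Local Notation Rn n := (n.-tuple (measurableTypeR R)).

Definition cons_pair n (p : measurableTypeR R * Rn n) : Rn n.+1 :=
  [tuple of p.1 :: p.2].

Fact measurable_cons_pair n : measurable_fun setT (@cons_pair n).
Proof. exact: measurable_cons. Qed.

Section Step.
Variables (n : nat) (m : {sigma_finite_measure set Rn n -> \bar R}).

Definition lebesgue_cons : set (Rn n.+1) -> \bar R :=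
  pushforward (lebesgue_measure \x m)%E (@cons_pair n).

Let lebesgue_cons0 : lebesgue_cons set0 = 0%E.
Proof. by rewrite /lebesgue_cons /pushforward preimage_set0 measure0. Qed.

Let lebesgue_cons_ge0 A : (0 <= lebesgue_cons A)%E.
Proof.
by rewrite /lebesgue_cons /pushforward; apply: integral_ge0 => x _ /=.
Qed.

Let lebesgue_cons_sigma_additive : semi_sigma_additive lebesgue_cons.
Proof.
exact: (@measure_semi_sigma_additive _ _ _
  (measure_function_pushforward__canonical__measure_function_Measure
     (lebesgue_measure \x m)%E (@measurable_cons_pair n))).
Qed.

HB.instance Definition _ := isMeasure.Build _ _ _ lebesgue_cons
  lebesgue_cons0 lebesgue_cons_ge0 lebesgue_cons_sigma_additive.

Fact lebesgue_cons_sigma_finite : sigma_finite setT lebesgue_cons.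
Proof.
have /sigma_finiteP[A [TA ndA Aoo]] := sigma_finiteT (@lebesgue_measure R).
have /sigma_finiteP[B [TB ndB Boo]] := sigma_finiteT m.
pose F k : set (measurableTypeR R * Rn n)%type := A k `*` B k.
have FT : setT = \bigcup_k F k.
  rewrite -setXTT TA TB predeqE => -[x y]; split; last first.
    by move=> [k _ []/= ? ?]; split; exists k.
  move=> [/= [k _ Akx] [l _ Bly]]; exists (maxn k l) => //; split.
    by move: x Akx; exact/subsetPset/ndA/leq_maxl.
  by move: y Bly; exact/subsetPset/ndB/leq_maxr.
have mF k : (measurable (F k) /\ (lebesgue_measure \x m) (F k) < +oo)%E.
  have [? ?] := Aoo k; have [? ?] := Boo k.
  split; first exact: measurableX.
  by rewrite product_measure1E// lte_mul_pinfty// ge0_fin_numE.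
pose uncons (t : Rn n.+1) := (thead t, [tuple of behead t] : Rn n).
have unconsK p : uncons (cons_pair p) = p.
  by case: p => x t; congr pair; apply: val_inj.
have muncons : measurable_fun setT uncons.
  by apply: measurable_fun_pair;
    [exact: measurable_tnth | exact: measurable_behead].
exists (fun k => uncons @^-1` F k).
  by rewrite -preimage_bigcup -FT preimage_setT.
move=> k; split.
  rewrite -[X in measurable X]setTI; apply: muncons => //.
  by case: (mF k).
rewrite /lebesgue_cons /pushforward.
rewrite (_ : _ @^-1` _ = F k); first by case: (mF k).
by apply/seteqP; split=> p /=; rewrite unconsK.
Qed.

HB.instance Definition _ := Measure_isSigmaFinite.Build _ _ _
  lebesgue_cons lebesgue_cons_sigma_finite.

End Step.

Fixpoint lebesgue_Rn (n : nat) : {sigma_finite_measure set Rn n -> \bar R} :=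
  if n is n'.+1 return {sigma_finite_measure set Rn n -> \bar R}
  then lebesgue_cons (lebesgue_Rn n') else \d_([tuple] : Rn 0).

End LebesgueRn.

Section Gaussian.
Context (R : realType) (n : nat).
Local Notation Rn := (n.-tuple (measurableTypeR R)).
Local Notation Sym := (Sym R n).

Definition vec (x : Rn) : 'cV[R]_n := \col_i tnth x i.

Definition normal0_pdf (S : Sym) (x : Rn) : R :=
  (Num.sqrt (\det ((2 * pi) *: (S : 'M[R]_n))))^-1 *
  expR (- ((vec x)^T *m invmx S *m vec x) 0 0 / 2).

Definition log_density (x : Rn) (S : Sym) : R := ln (normal0_pdf S x).

Definition expectation0 (S : Sym) (f : Rn -> R) : R :=
  \int[lebesgue_Rn n]_x (f x * normal0_pdf S x).

Definition fisher_metric (S X Y : Sym) : R :=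
  expectation0 S (fun x => 'D_X (log_density x) S * 'D_Y (log_density x) S).

Definition amari_chentsov (alpha : R) : Sym -> Sym -> Sym -> Sym -> R :=
  patch (fun=> 0) (@SymPos R n) (fun S X Y Z => alpha * expectation0 S
    (fun x => 'D_X (log_density x) S * 'D_Y (log_density x) S *
              'D_Z (log_density x) S)).

End Gaussian.

Definition SP3 (R : realType) (n : nat) : set (mpoly.mpoly n R) :=
  [set p : mpoly.mpoly n R |
    (p \is mpoly.ishomog1 3 (@mpoly.mdeg n)) /\ (p \is mpoly.symmetric)].

(* Main.v *)
(* An invariant tensor field on [GL(n)/O(n)] is parallel for the canonical
   connection [nabla_X Y = D_X Y - (X S^-1 Y + Y S^-1 X) / 2], which is thus the
   Levi-Civita connection of every invariant metric.  Hence [nabla C = 0] for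
   every invariant cubic form [C], which gives (1).

   By transitivity and polarization, [C] is determined by the cubic form
   [X |-> C(X, X, X)] at the identity, hence, by the spectral theorem, by its
   values on diagonal matrices, where it is a cubic polynomial in the eigenvalues
   that is invariant under permutation matrices: this polynomial is [Phi C].
   A permutation-invariant coefficient family [c i j k] depends only on the
   coincidences among [i, j, k], so [C] is a combination of [tr X tr Y tr Z], the
   symmetrization of [tr X tr (Y Z)], and [tr (X Y Z)] (at the identity).

   For the Fisher metric and the Amari-Chentsov tensor, factor [S^-1 = L L^T] and
   substitute [y = L^T x]: the scores become quadratic polynomials in a standard
   Gaussian vector, and Stein's identity [E(y_i p) = E(d_i p)] computes the
   expectations of their products. *)

From HB Require Import structures.
From mathcomp Require Import perm.
Require Import Defs.
From mathcomp Require Import all_boot all_order all_algebra.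
From mathcomp Require Import all_classical all_reals all_analysis.
From mathcomp Require Import measurable_realfun.
From mathcomp Require complex.
From mathcomp Require Import (canonicals, coercions) mpoly.
From mathcomp Require Import ring lra.
Import Order.TTheory GRing.Theory Num.Theory.
Import numFieldNormedType.Exports.
Local Open Scope classical_set_scope.
Local Open Scope ring_scope.

Set Implicit Arguments.
Unset Strict Implicit.
Unset Printing Implicit Defensive.

(** Smoothness is that of total functions on an open set, expressed by iterated directional
    derivatives. Since the canonical connection contains [S^-1], its smoothness is brought down to
    real functions, entry by entry, through determinants and cofactors. Positive matrices are
    factored by Cholesky rather than by a square root. A triangular change of variables in an
    iterated integral is a succession of affine substitutions in one variable, and this replaces a
    Jacobian formula; the same factorization gives transitivity of the action and openness of
    [SymPos]. The derivative of the log-density instead diagonalizes the base point and the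
    direction together. The three trace forms become dependent for small [n]: they are proportional
    if [n = 1], and the polarized Cayley-Hamilton identity relates them if [n = 2]. The
    classification therefore normalizes the coefficients: [u], that of the product of traces, is 0
    if [n < 3], and [v], that of the mixed form, is 0 if [n < 2]. *)

Section Calculus.
Context {R : realType}.
Implicit Types V W : normedModType R.

(** The difference vanishes near [p], so it is [o(id)] there and has differential 0. *)
Lemma near_eq_differentiable V W (f g : V -> W) (p : V) :
  (\near p, f p = g p) -> differentiable f p -> differentiable g p.
Proof.
move=> fg df; have -> : g = f + (g - f) by rewrite addrC subrK.
apply: differentiableD => //; set h := g - f.
have h0 : \near p, h p = 0.
  by near=> q; rewrite /h fctE; apply/eqP; rewrite subr_eq0 eq_sym; apply/eqP; near: q.
have hp : h p = 0 by exact: nbhs_singleton h0.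
have E : h \o shift p = cst (h p) + (\0 : {linear V -> W}) +o_ (0 : V) id.
  apply/eqaddoP => e e0; near=> x.
  rewrite /= !fctE /= hp addr0 subr0.
  suff -> : h (x + p) = 0 by rewrite normr0 mulr_ge0// ltW.
  near: x.
  have /(_ _ h0) : (fun x => x + p) @ (0 : V) --> p.
    by rewrite -[X in _ --> X]add0r; apply: cvgD; [exact: cvg_id|exact: cvg_cst].
  by apply.
have c0 : continuous (\0 : {linear V -> W}) by exact: cst_continuous.
by apply/diff_locallyP; rewrite (diff_unique c0 E).
Unshelve. all: by end_near. Qed.

Context {V : normedModType R} (U : set V).

Lemma C_on_differentiable W k (f : V -> W) (p : V) :
  C_on k.+1 U f -> U p -> differentiable f p.
Proof. by move=> [df _]; exact: df. Qed.

Lemma C_onW W k (f : V -> W) : C_on k.+1 U f -> C_on k U f.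
Proof.
elim: k f => [|k IH] f [df Df].
  by move=> p Up; exact/differentiable_continuous/df.
by split=> // v; exact/IH/Df.
Qed.

Lemma smooth_on_derive W (f : V -> W) v : smooth_on U f -> smooth_on U ('D_v f).
Proof. by move=> sf k; have [_ Df] := sf k.+1; exact: Df. Qed.

Lemma smooth_on_differentiable W (f : V -> W) p :
  smooth_on U f -> U p -> differentiable f p.
Proof. by move=> sf; exact: C_on_differentiable (sf 1%N). Qed.

Lemma C_on_cst W k (w : W) : C_on k U (cst w).
Proof.
elim: k w => [|k IH] w; first by move=> p _; exact: cst_continuous.
split=> [p _|v]; first exact: differentiable_cst.
by rewrite (_ : 'D_v _ = cst 0)//; apply/funext => p; rewrite derive_cst.
Qed.

Hypothesis oU : open U.

Lemma open_near_eq W (f g : V -> W) p :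
  (forall q, U q -> f q = g q) -> U p -> \near p, f p = g p.
Proof.
by move=> fg Up; near=> q; apply: fg; near: q; exact: open_nbhs_nbhs.
Unshelve. all: by end_near. Qed.

(** Openness turns agreement on [U] into agreement near each of its points, so all directional
    derivatives agree on [U] as well. Differentiation rules thus need to be checked on [U] only. *)
Lemma C_on_eq W k (f g : V -> W) :
  (forall p, U p -> f p = g p) -> C_on k U f -> C_on k U g.
Proof.
elim: k f g => [|k IH] f g fg /=.
  move=> cf p Up; have fgp := open_near_eq fg Up.
  have := cf p Up; rewrite /prop_for /continuous_at (fg _ Up).
  apply: cvg_trans; apply: near_eq_cvg.
  by near=> q; apply: (near fgp).
move=> -[df Df]; split=> [p Up|v].
  exact: near_eq_differentiable (open_near_eq fg Up) (df p Up).
apply: IH (Df v) => p Up; apply: near_eq_derive; exact: open_near_eq.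
Unshelve. all: by end_near. Qed.

Lemma C_onD W k (f g : V -> W) :
  C_on k U f -> C_on k U g -> C_on k U (f + g).
Proof.
elim: k f g => [|k IH] f g.
  by move=> cf cg p Up; apply: cvgD; [exact: cf|exact: cg].
move=> [df Df] [dg Dg]; split=> [p Up|v].
  by apply: differentiableD; [exact: df|exact: dg].
apply: C_on_eq (IH _ _ (Df v) (Dg v)) => p Up.
by rewrite deriveD//; apply: diff_derivable; [exact: df|exact: dg].
Qed.

Lemma C_onM k (f g : V -> R) :
  C_on k U f -> C_on k U g -> C_on k U (f * g).
Proof.
elim: k f g => [|k IH] f g.
  by move=> cf cg p Up; apply: cvgM; [exact: cf|exact: cg].
move=> Cf Cg; have [df Df] := Cf; have [dg Dg] := Cg; split=> [p Up|v].
  by apply: differentiableM; [exact: df|exact: dg].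
apply: C_on_eq (C_onD (IH _ _ (C_onW Cf) (Dg v)) (IH _ _ (C_onW Cg) (Df v))).
move=> p Up; rewrite deriveM//; apply: diff_derivable; [exact: df|exact: dg].
Qed.

Lemma C_on_comp_linear W W' (L : {linear W -> W'}) k (f : V -> W) :
  continuous L -> C_on k U f -> C_on k U (L \o f).
Proof.
move=> cL; elim: k f => [|k IH] f.
  by move=> cf p Up; apply: cvg_comp (cf p Up) _; exact: cL.
move=> [df Df]; split=> [p Up|v].
  by apply: differentiable_comp; [exact: df|exact: linear_differentiable].
apply: C_on_eq (IH _ (Df v)) => p Up /=.
have dL := @linear_differentiable _ _ _ L (f p) cL.
have dfp := df p Up.
rewrite (deriveE v dfp) (deriveE v (differentiable_comp dfp dL)).
by rewrite (diff_comp dfp dL) (diff_lin _ cL).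
Qed.

Lemma C_on_linear W (L : {linear V -> W}) k : continuous L -> C_on k U L.
Proof.
move=> cL; case: k => [|k]; first by move=> p _; exact: cL.
split=> [p _|v]; first exact: linear_differentiable.
apply: C_on_eq (C_on_cst k (L v)) => p Up.
have dL := @linear_differentiable _ _ _ L p cL.
by rewrite (deriveE v dL) (diff_lin _ cL).
Qed.

(** Induction on [k]: the derivative of [1/f] is the product of [-1], two factors [1/f] and the
    derivative of [f], all of class [k]. *)
Lemma C_onV k (f : V -> R) : (forall p, U p -> f p != 0) ->
  C_on k U f -> C_on k U (fun p => (f p)^-1).
Proof.
move=> f0; elim: k => [|k IH].
  by move=> cf p Up; apply: cvgV; [exact: f0|exact: cf].
move=> Cf; have [df Df] := Cf; split=> [p Up|v].
  by apply: differentiableV; [exact: df|exact: f0].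
have C1 := IH (C_onW Cf).
have C2 : C_on k U (cst (-1) : V -> R) by exact: C_on_cst.
apply: C_on_eq (C_onM C2 (C_onM (C_onM C1 C1) (Df v))).
move=> p Up; rewrite deriveV ?f0//; last exact/diff_derivable/df.
by rewrite !fctE /cst /= expr2 invfM mulN1r scaleNr.
Qed.

Lemma smooth_on_cst W (w : W) : smooth_on U (cst w).
Proof. by move=> k; exact: C_on_cst. Qed.

Lemma smooth_on_eq W (f g : V -> W) :
  (forall p, U p -> f p = g p) -> smooth_on U f -> smooth_on U g.
Proof. by move=> fg sf k; exact: C_on_eq fg (sf k). Qed.

Lemma smooth_onD W (f g : V -> W) :
  smooth_on U f -> smooth_on U g -> smooth_on U (fun p => f p + g p).
Proof. by move=> sf sg k; exact: C_onD. Qed.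

Lemma smooth_onM (f g : V -> R) :
  smooth_on U f -> smooth_on U g -> smooth_on U (fun p => f p * g p).
Proof. by move=> sf sg k; exact: C_onM. Qed.

Lemma smooth_onV (f : V -> R) : (forall p, U p -> f p != 0) ->
  smooth_on U f -> smooth_on U (fun p => (f p)^-1).
Proof. by move=> f0 sf k; exact: C_onV. Qed.

Lemma smooth_on_sum W (I : Type) (r : seq I) (P : pred I) (f : I -> V -> W) :
  (forall i, P i -> smooth_on U (f i)) ->
  smooth_on U (fun p => \sum_(i <- r | P i) f i p).
Proof.
move=> sf; elim: r => [|i r IH].
  by apply: (smooth_on_eq (f := cst 0)) (smooth_on_cst 0) => p _; rewrite big_nil.
under eq_fun do rewrite big_cons.
by have [Pi|_] := boolP (P i) => //; apply: smooth_onD => //; exact: sf.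
Qed.

Lemma smooth_on_prod (I : Type) (r : seq I) (P : pred I) (f : I -> V -> R) :
  (forall i, P i -> smooth_on U (f i)) ->
  smooth_on U (fun p => \prod_(i <- r | P i) f i p).
Proof.
move=> sf; elim: r => [|i r IH].
  by apply: (@smooth_on_eq R (cst 1)) => [p _|]; [rewrite big_nil|exact: smooth_on_cst].
under eq_fun do rewrite big_cons.
by have [Pi|_] := boolP (P i) => //; apply: smooth_onM => //; exact: sf.
Qed.

Lemma smooth_on_comp_linear W W' (L : {linear W -> W'}) (f : V -> W) :
  continuous L -> smooth_on U f -> smooth_on U (L \o f).
Proof. by move=> cL sf k; exact: C_on_comp_linear. Qed.

Lemma smooth_onZr W (w : W) (f : V -> R) :
  smooth_on U f -> smooth_on U (fun p => f p *: w).
Proof.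
have lw : linear (fun a : R => a *: w) by move=> a x y; rewrite scalerDl -scalerA.
pose L : {linear R -> W} := HB.pack (fun a : R => a *: w) (GRing.isLinear.Build _ _ _ _ _ lw).
by move=> sf; apply: (@smooth_on_comp_linear R W L) => //; exact: scalel_continuous.
Qed.

End Calculus.

(** * Spectral theorem and Cholesky factorization *)

Section RowSquares.
Context {R : rcfType}.

Lemma mulmx_tr_rowE n (u v : 'rV[R]_n) : (u *m v^T) 0 0 = \sum_i u 0 i * v 0 i.
Proof. by rewrite mxE; apply: eq_bigr => i _; rewrite mxE. Qed.

Lemma mulmx_tr_row_ge0 n (u : 'rV[R]_n) : 0 <= (u *m u^T) 0 0.
Proof. by rewrite mulmx_tr_rowE sumr_ge0// => i _; rewrite -expr2 sqr_ge0. Qed.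

Lemma mulmx_tr_row_gt0 n (u : 'rV[R]_n) : u != 0 -> 0 < (u *m u^T) 0 0.
Proof.
move=> u0; rewrite lt_neqAle mulmx_tr_row_ge0 andbT eq_sym; apply: contra u0.
rewrite mulmx_tr_rowE psumr_eq0 => [/allP h|i _]; last by rewrite -expr2 sqr_ge0.
apply/eqP/rowP => i; have := h i (mem_index_enum _).
by rewrite mxE -expr2 sqrf_eq0 => /eqP.
Qed.

End RowSquares.

Section RealSpectral.
Import complex.

(** Over the complex numbers there is an eigenvector [x + iy] with eigenvalue [a + ib]. Computing
    [x A y^T] in two ways, by symmetry, gives [b (|x|^2 + |y|^2) = 0]. Hence [b = 0], and whichever
    of [x], [y] is nonzero is a real eigenvector. *)
Lemma symmetric_eigenvector (R : rcfType) n (A : 'M[R]_n.+1) : A^T = A ->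
  exists (a : R) (v : 'rV_n.+1), v != 0 /\ v *m A = a *: v.
Proof.
move=> AT; pose Ac := map_mx (real_complex R) A.
have [z] := eigenvalue_closed Ac (ltn0Sn n).
move=> /eigenvalueP[v /rowP vA v0].
pose x : 'rV[R]_n.+1 := map_mx (@Re R) v; pose y : 'rV[R]_n.+1 := map_mx (@Im R) v.
pose a := Re z; pose b := Im z.
have xA : x *m A = a *: x - b *: y.
  apply/rowP => j; have /(congr1 (@Re R)) := vA j; rewrite !mxE raddf_sum /=.
  case: z @a @b {vA} => a b /=; case: (v 0 j) => s t /= <-.
  by apply: eq_bigr => i _; rewrite !mxE; case: (v 0 i) => p q /=; rewrite mulr0 subr0.
have yA : y *m A = a *: y + b *: x.
  apply/rowP => j; have /(congr1 (@Im R)) := vA j; rewrite !mxE raddf_sum /=.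
  case: z @a @b {vA xA} => a b /=; case: (v 0 j) => s t /= <-.
  by apply: eq_bigr => i _; rewrite !mxE; case: (v 0 i) => p q /=; rewrite mulr0 add0r.
have xy0 : (x != 0) || (y != 0).
  rewrite -negb_and; apply: contra v0 => /andP[/eqP/rowP x0 /eqP/rowP y0].
  apply/eqP/rowP => j; have := x0 j; have := y0 j; rewrite !mxE.
  by case: (v 0 j) => s t /= -> ->.
have b0 : b * ((x *m x^T) 0 0 + (y *m y^T) 0 0) = 0.
  have : (x *m A) *m y^T = x *m (y *m A)^T by rewrite trmx_mul AT mulmxA.
  rewrite xA yA mulmxBl -!scalemxAl raddfD/= !linearZ/= mulmxDr -!scalemxAr.
  move: (x *m y^T) (x *m x^T) (y *m y^T) => P X Y.
  move=> /(congr1 (fun M : 'M[R]_1 => M 0 0)); rewrite !mxE => h.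
  by move: h; lra.
have {}b0 : b = 0.
  move/eqP: b0; rewrite mulf_eq0 => /orP[/eqP//|/eqP h]; exfalso.
  move/eqP: h; rewrite paddr_eq0 ?mulmx_tr_row_ge0// => /andP[/eqP hx /eqP hy].
  by case/orP: xy0 => /mulmx_tr_row_gt0; rewrite ?hx ?hy ltxx.
rewrite b0 scale0r subr0 in xA; rewrite b0 scale0r addr0 in yA.
by case/orP: xy0 => ?; [exists a, x | exists a, y].
Qed.

End RealSpectral.

Section RealMatrices.
Context {R : rcfType}.

(* Householder: reflect [v] onto the first basis vector. *)
Lemma unit_row_reflection n (v : 'rV[R]_n.+1) : v *m v^T = 1 ->
  exists Q : 'M[R]_n.+1, [/\ Q^T = Q, Q *m Q = 1%:M & delta_mx 0 0 *m Q = v].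
Proof.
move=> v1; pose e : 'rV[R]_n.+1 := delta_mx 0 0.
have [->|ve] := eqVneq v e; first by exists 1%:M; rewrite trmx1 !mulmx1.
have [w wE] : exists w, w = v - e by exists (v - e).
have w0 : w != 0 by rewrite wE subr_eq0.
pose c := (w *m w^T) 0 0; have c0 : c != 0 by rewrite gt_eqF// mulmx_tr_row_gt0.
have ww : w *m w^T = c%:M by rewrite [LHS]mx11_scalar.
pose t := (v *m e^T) 0 0.
have ve1 : v *m e^T = t%:M by rewrite [LHS]mx11_scalar.
have ev1 : e *m v^T = t%:M by rewrite -[LHS]trmxK trmx_mul trmxK ve1 tr_scalar_mx.
have ee : e *m e^T = 1%:M.
  by rewrite trmx_delta mul_delta_mx; apply/matrixP => i j; rewrite !mxE !ord1.
have cE : c = 2 - 2 * t.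
  rewrite /c wE raddfB/= mulmxBl !mulmxBr v1 ee ve1 ev1 !mxE /=; ring.
pose Q : 'M[R]_n.+1 := 1%:M - (2 / c) *: (w^T *m w).
exists Q; split.
- by rewrite /Q raddfB/= trmx1 linearZ/= trmx_mul trmxK.
- rewrite /Q mulmxBl mul1mx mulmxBr mulmx1 -scalemxAl -scalemxAr scalerA.
  rewrite -mulmxA (mulmxA w) ww mul_scalar_mx -scalemxAr scalerA.
  rewrite (_ : 2 / c * (2 / c) * c = 2 * (2 / c)); last by field.
  apply/matrixP => i j; rewrite !mxE; ring.
- have ew : e *m w^T = (t - 1)%:M by rewrite wE raddfB/= mulmxBr ev1 ee -raddfB.
  rewrite /Q mulmxBr mulmx1 -scalemxAr mulmxA -/e ew mul_scalar_mx scalerA.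
  rewrite (_ : 2 / c * (t - 1) = -1); first by rewrite scaleN1r opprK wE addrC subrK.
  by rewrite cE; field; rewrite -cE.
Qed.

(** Deflation: once a unit eigenvector is reflected onto the first basis vector, the first row is a
    multiple of that vector, symmetry clears the first column too, and the remaining block is
    diagonalized by induction. *)
Lemma symmetric_orthogonal_diag n (A : 'M[R]_n) : A^T = A ->
  exists Q : 'M[R]_n, Q *m Q^T = 1%:M /\ is_diag_mx (Q *m A *m Q^T).
Proof.
elim: n A => [|n IH] A AT.
  by exists 1%:M; rewrite trmx1 mulmx1; split=> //; apply/is_diag_mxP => -[].
have [a [v [v0 vA]]] := symmetric_eigenvector AT.
pose s := Num.sqrt ((v *m v^T) 0 0).
have s0 : s != 0 by rewrite gt_eqF// sqrtr_gt0 mulmx_tr_row_gt0.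
pose u := s^-1 *: v.
have u1 : u *m u^T = 1.
  rewrite /u linearZ/= -scalemxAl -scalemxAr scalerA [v *m _]mx11_scalar.
  rewrite -[X in _ *: X%:M]sqr_sqrtr ?mulmx_tr_row_ge0//.
  by rewrite scale_scalar_mx -/s -expr2 -exprMn mulVf// expr1n.
have uA : u *m A = a *: u by rewrite /u -scalemxAl vA !scalerA mulrC.
have [Q [QT QQ eQ]] := unit_row_reflection u1.
pose B : 'M[R]_(1 + n) := Q *m A *m Q.
have BT : B^T = B by rewrite /B !trmx_mul QT AT mulmxA.
have B0 : row 0 B = a *: delta_mx 0 0.
  by rewrite rowE /B !mulmxA eQ uA -scalemxAl -eQ -mulmxA QQ mulmx1.
pose B' := drsubmx B.
have BE : B = block_mx a%:M 0 0 B'.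
  have ur0 : ursubmx B = 0.
    apply/matrixP => i j; move/rowP: B0 => /(_ (rshift 1 j)); rewrite !mxE !ord1 /=.
    by rewrite (_ : lshift n 0 = 0) ?mulr0//; apply: val_inj.
  rewrite -[B]submxK -/B' ur0; congr block_mx; last first.
    by rewrite -[RHS]trmx0 -ur0 trmx_ursub BT.
  apply/matrixP => i j; move/rowP: B0 => /(_ 0); rewrite !mxE !ord1 /=.
  rewrite mulr1 (_ : lshift n 0 = 0) ?mulr1n//; apply: val_inj => //.
have B'T : B'^T = B' by rewrite /B' trmx_drsub BT.
have [Q' [Q'1 Q'D]] := IH _ B'T.
pose P : 'M[R]_(1 + n) := block_mx 1%:M 0 0 Q'.
have PT : P^T = block_mx 1%:M 0 0 Q'^T by rewrite tr_block_mx !trmx0 trmx1.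
have PP : P *m P^T = 1%:M.
  rewrite PT /P mulmx_block Q'1.
  by rewrite !(mul0mx, mulmx0, mulmx1, addr0, add0r) -scalar_mx_block.
have PBP : P *m B *m P^T = block_mx a%:M 0 0 (Q' *m B' *m Q'^T).
  rewrite BE PT /P !mulmx_block.
  by rewrite !(mul0mx, mulmx0, mulmx1, mul1mx, addr0, add0r).
exists (P *m Q); split.
  by rewrite trmx_mul QT mulmxA -(mulmxA P) QQ mulmx1.
rewrite trmx_mul QT !mulmxA -(mulmxA P Q) -(mulmxA P) -/B PBP.
by rewrite (@is_diag_block_mx _ 1 n 1 n)// !eqxx mx11_is_diag.
Qed.

Definition posdef n (A : 'M[R]_n) :=
  forall x : 'cV[R]_n, x != 0 -> 0 < (x^T *m A *m x) 0 0.

(** Block elimination: with pivot [a = s^2], the first column of the factor is [(s, b/s)], and the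
    rest factors the Schur complement [D']. *)
Lemma cholesky n (A : 'M[R]_n) : A^T = A -> posdef A ->
  exists L : 'M[R]_n, [/\ is_trig_mx L, forall i, 0 < L i i & A = L *m L^T].
Proof.
elim: n A => [|n IH] A AT Apos.
  by exists 0; split=> [||]; [exact: mx0_is_trig|case|apply/matrixP => -[]].
change 'M[R]_(1 + n) in A.
pose a := A 0 0; pose b := dlsubmx A; pose D := drsubmx A.
have ulA : ulsubmx A = a%:M.
  apply/matrixP => i j; rewrite !mxE !ord1 /= mulr1n.
  by congr (A _ _); apply: val_inj.
have urA : ursubmx A = b^T by rewrite /b trmx_dlsub AT.
have AE : A = block_mx a%:M b^T b D by rewrite -[LHS]submxK ulA urA.
have DT : D^T = D by rewrite /D trmx_drsub AT.
have a0 : 0 < a.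
  have /Apos : (delta_mx 0 0 : 'cV[R]_(1 + n)) != 0.
    by apply/eqP => /colP /(_ 0); rewrite !mxE /= => /eqP; rewrite oner_eq0.
  by rewrite trmx_delta -rowE -colE !mxE.
pose s := Num.sqrt a; have s0 : 0 < s by rewrite sqrtr_gt0.
have ss : s * s = a by rewrite -expr2 sqr_sqrtr// ltW.
pose D' := D - a^-1 *: (b *m b^T).
have D'T : D'^T = D' by rewrite /D' raddfB/= linearZ/= trmx_mul trmxK DT.
have [L [Ltrig Lpos LE]] : exists L : 'M[R]_n,
    [/\ is_trig_mx L, forall i, 0 < L i i & D' = L *m L^T].
  apply: IH => // x x0.
  (* Among the vectors with tail [x], this one minimizes the quadratic form of [A]: the cross terms
     cancel and the value left is that of [D'] at [x]. *)
  pose z : 'cV[R]_(1 + n) := col_mx (- a^-1 *: (b^T *m x)) x.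
  have z0 : z != 0.
    apply: contra x0 => /eqP z0; apply/eqP.
    rewrite -(col_mxKd (- a^-1 *: (b^T *m x)) x) -/z z0.
    by apply/colP => i; rewrite !mxE.
  have tz : (- a^-1 *: (b^T *m x))^T = - a^-1 *: (x^T *m b).
    by rewrite linearZ/= trmx_mul trmxK.
  have zAz : z^T *m A *m z = x^T *m D' *m x.
    rewrite AE /z tr_col_mx mul_row_block mul_row_col.
    rewrite tz -!scalemxAl mul_mx_scalar scalerA.
    rewrite mulNr mulVf ?gt_eqF// scaleN1r [- _ + _]addrC subrr mul0mx add0r.
    rewrite mulmxDl -!scalemxAl -!mulmxA.
    by rewrite /D' mulmxBl mulmxBr -scalemxAl -scalemxAr -!mulmxA addrC scaleNr.
  by have := Apos z z0; rewrite -[X in 0 < X]/((z^T *m A *m z) 0 0) zAz.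
pose M : 'M[R]_(1 + n) := block_mx s%:M 0 (s^-1 *: b) L.
have Mdiag (i : 'I_(1 + n)) : 0 < M i i.
  case: (split_ordP i) => j ->; last by rewrite block_mxEdr.
  by rewrite block_mxEul mxE ord1 eqxx mulr1n.
have ME : A = M *m M^T.
  rewrite tr_block_mx mulmx_block trmx0 !(mul0mx, mulmx0, addr0).
  rewrite tr_scalar_mx linearZ/= -scalar_mxM ss AE; congr block_mx.
  - by rewrite mul_scalar_mx scalerA mulfV ?scale1r// gt_eqF.
  - by rewrite mul_mx_scalar scalerA mulfV ?scale1r// gt_eqF.
  - rewrite -LE /D' -scalemxAl -scalemxAr scalerA -invfM ss.
    by rewrite addrC subrK.
exists M; split=> //.
by rewrite (@is_trig_block_mx _ 1 n 1 n)// eqxx mx11_is_trig.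
Qed.

Lemma posdef_unitmx n (A : 'M[R]_n) : posdef A -> A \in unitmx.
Proof.
move=> Apos; rewrite -unitmx_tr -row_free_unit -kermx_eq0.
apply/negPn/negP => /rowV0Pn[v /sub_kermxP vA v0].
have : v^T != 0 by rewrite -(inj_eq (can_inj (@trmxK _ _ _))) trmxK trmx0.
by move=> /Apos; rewrite trmxK -mulmxA -[A *m _]trmxK trmx_mul trmxK vA trmx0 mulmx0 mxE ltxx.
Qed.

End RealMatrices.

(** * Symmetric matrices as a smooth manifold *)

Section SmoothMatrices.
Context {R : realType} {V : normedModType R} (U : set V).
Hypothesis oU : open U.

Definition smooth_mx m k (f : V -> 'M[R]_(m, k)) :=
  forall i j, smooth_on U (fun p => f p i j).

Lemma smooth_mx_cst m k (A : 'M[R]_(m, k)) : smooth_mx (fun=> A).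
Proof. by move=> i j; exact: smooth_on_cst. Qed.

Lemma smooth_mxD m k (f g : V -> 'M[R]_(m, k)) :
  smooth_mx f -> smooth_mx g -> smooth_mx (fun p => f p + g p).
Proof.
move=> sf sg i j; under eq_fun do rewrite mxE.
by apply: smooth_onD.
Qed.

Lemma smooth_mxZ m k (a : V -> R) (f : V -> 'M[R]_(m, k)) :
  smooth_on U a -> smooth_mx f -> smooth_mx (fun p => a p *: f p).
Proof.
move=> sa sf i j; under eq_fun do rewrite mxE.
by apply: smooth_onM.
Qed.

Lemma smooth_mxM m k l (f : V -> 'M[R]_(m, k)) (g : V -> 'M[R]_(k, l)) :
  smooth_mx f -> smooth_mx g -> smooth_mx (fun p => f p *m g p).
Proof.
move=> sf sg i j; under eq_fun do rewrite mxE.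
apply: smooth_on_sum => // h _.
by apply: smooth_onM.
Qed.

Lemma smooth_on_mxtrace m (f : V -> 'M[R]_m) :
  smooth_mx f -> smooth_on U (fun p => \tr (f p)).
Proof. by move=> sf; apply: smooth_on_sum => // i _; exact: sf. Qed.

Lemma smooth_on_det m (f : V -> 'M[R]_m) :
  smooth_mx f -> smooth_on U (fun p => \det (f p)).
Proof.
move=> sf; apply: smooth_on_sum => // s _.
apply: smooth_onM => //; first exact: smooth_on_cst.
by apply: smooth_on_prod => // i _; exact: sf.
Qed.

(** Cramer's rule: each entry is a cofactor divided by a determinant that does not vanish on [U]. *)
Lemma smooth_mx_inv m (f : V -> 'M[R]_m) :
  (forall p, U p -> f p \in unitmx) -> smooth_mx f ->
  smooth_mx (fun p => invmx (f p)).
Proof.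
move=> fu sf i j.
apply: (@smooth_on_eq R V U oU R (fun p => (\det (f p))^-1 * (\adj (f p)) i j)).
  by move=> p Up; rewrite /invmx fu// [RHS]mxE.
apply: smooth_onM => //.
  apply: smooth_onV => //; last exact: smooth_on_det.
  by move=> p Up; have := fu p Up; rewrite unitmxE unitfE.
under eq_fun do rewrite mxE; apply: smooth_onM => //; first exact: smooth_on_cst.
by apply: smooth_on_det => a b; under eq_fun do rewrite !mxE; exact: sf.
Qed.

End SmoothMatrices.

Section SymTopology.
Context {R : realType} {n : nat}.
Local Notation Sym := (Sym R n).
Implicit Types (A S : Sym) (i j : 'I_n).

Lemma sym_trmx A : (A : 'M[R]_n)^T = A.
Proof. by case: A => A /= /eqP. Qed.

Definition sym_coord i j A : R := A i j.

Fact sym_coord_linear i j : linear (sym_coord i j : Sym -> R).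
Proof. by move=> a A B; rewrite /sym_coord /= !mxE. Qed.

HB.instance Definition _ i j := GRing.isLinear.Build R Sym R *:%R
  (sym_coord i j) (@sym_coord_linear i j).

Lemma sym_coord_le i j A : `|sym_coord i j A| <= `|A|.
Proof.
have -> : `|A| = mx_norm (A : 'M[R]_n) by [].
rewrite mx_normrE.
exact: (le_bigmax _ (fun ij => `|(A : 'M[R]_n) ij.1 ij.2|) (i, j)).
Qed.

Lemma sym_coord_continuous i j : continuous (sym_coord i j : Sym -> R).
Proof.
apply: bounded_linear_continuous; exists 1; split=> // M M1.
near=> A; apply: le_trans (sym_coord_le i j A) _; apply: ltW.
by apply: lt_trans M1; near: A; exact: nbhs0_lt.
Unshelve. all: by end_near. Qed.

Fact sym_base_subproof i j :
  2^-1 *: (delta_mx i j + delta_mx j i) \in @Defs.is_sym R n.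
Proof. by rewrite inE linearZ/= raddfD/= !trmx_delta addrC. Qed.

(* Not a basis: [sym_base i j = sym_base j i]. *)
Definition sym_base i j : Sym := MkSym (sym_base_subproof i j).

Lemma sym_sumE A : A = \sum_i \sum_j sym_coord i j A *: sym_base i j.
Proof.
apply: val_inj; rewrite raddf_sum.
under eq_bigr do rewrite raddf_sum.
transitivity (2^-1 *: ((A : 'M[R]_n) + (A : 'M[R]_n)^T)).
  by rewrite sym_trmx -mulr2n -(scaler_nat 2 (A : 'M[R]_n)) scalerA mulVf ?scale1r// pnatr_eq0.
rewrite {2}(matrix_sum_delta A) {1}(matrix_sum_delta A) raddf_sum/= -big_split/= scaler_sumr.
apply: eq_bigr => i _; rewrite raddf_sum/= -big_split/= scaler_sumr.
apply: eq_bigr => j _; rewrite [RHS]linearZ linearZ/= trmx_delta -scalerDr !scalerA mulrC.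
by rewrite -scalerA.
Qed.

Lemma sym_linear_sumE (W : lmodType R) (L : {linear Sym -> W}) A :
  L A = \sum_i \sum_j sym_coord i j A *: L (sym_base i j).
Proof.
rewrite {1}[A]sym_sumE raddf_sum/=; apply: eq_bigr => i _.
by rewrite raddf_sum/=; apply: eq_bigr => j _; rewrite linearZ.
Qed.

Lemma smooth_on_sym_coord (V : normedModType R) (U : set V) (f : V -> Sym) i j :
  open U -> smooth_on U f -> smooth_on U (fun p => sym_coord i j (f p)).
Proof.
move=> oU; apply: (@smooth_on_comp_linear _ _ _ oU _ _ (sym_coord i j)).
exact: sym_coord_continuous.
Qed.

Lemma smooth_on_sym (V : normedModType R) (U : set V) (f : V -> Sym) :
  open U -> (forall i j, smooth_on U (fun p => sym_coord i j (f p))) ->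
  smooth_on U f.
Proof.
move=> oU sf; apply: (@smooth_on_eq _ _ _ oU _
  (fun p => \sum_i \sum_j sym_coord i j (f p) *: sym_base i j)).
  by move=> p _; rewrite -sym_sumE.
apply: smooth_on_sum => // i _; apply: smooth_on_sum => // j _.
by apply: smooth_onZr => //; exact: sf.
Qed.

(** By finite dimension, [L] is a finite combination of the coordinates, which are continuous
    because they are bounded by the norm. *)
Lemma sym_linear_continuous (W : normedModType R) (L : {linear Sym -> W}) :
  continuous L.
Proof.
suff /(_ 0%N) sL : smooth_on setT L by move=> A; exact: sL.
apply: (@smooth_on_eq _ _ _ openT _
  (fun A => \sum_i \sum_j sym_coord i j A *: L (sym_base i j))).
  by move=> A _; rewrite -sym_linear_sumE.
apply: (smooth_on_sum openT) => i _; apply: (smooth_on_sum openT) => j _.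
apply: (smooth_onZr openT) => k; apply: (C_on_linear openT (L := sym_coord i j)).
exact: sym_coord_continuous.
Qed.

Lemma diff_sym_linear (W : normedModType R) (L : {linear Sym -> W}) A :
  'd L A = L :> (Sym -> W).
Proof. by rewrite diff_lin//; exact: sym_linear_continuous. Qed.

Fact act_linear (h : 'M[R]_n) : linear (act h).
Proof.
move=> a A B; apply: val_inj; rewrite /= mulmxDr mulmxDl.
by rewrite -scalemxAr -scalemxAl.
Qed.

HB.instance Definition _ (h : 'M[R]_n) := GRing.isLinear.Build R Sym Sym *:%R
  (act h) (@act_linear h).

Lemma SymPos_unitmx S : SymPos S -> (S : 'M[R]_n) \in unitmx.
Proof. exact: posdef_unitmx. Qed.

Lemma SymPos_cholesky S : SymPos S ->
  exists L : 'M[R]_n, [/\ is_trig_mx L, forall i, 0 < L i i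
    & (S : 'M[R]_n) = L *m L^T].
Proof. by move=> S0; apply: cholesky => //; exact: sym_trmx. Qed.

Lemma trig_posdiag_unitmx (L : 'M[R]_n) :
  is_trig_mx L -> (forall i, 0 < L i i) -> L \in unitmx.
Proof.
move=> Lt L0; rewrite unitmxE det_trig// unitfE prodf_seq_neq0.
by apply/allP => i _; rewrite gt_eqF// implybT.
Qed.

Lemma mulmx_tr_colE m (u v : 'cV[R]_m) : (u^T *m v) 0 0 = \sum_i u i 0 * v i 0.
Proof. by rewrite mxE; apply: eq_bigr => i _; rewrite mxE. Qed.

(** The congruence by [M = L^-1] carries [S] to the identity and a nearby [T] to [1 + W] with [W]
    small. If the entries of [W] are small enough, [|y^T W y|] stays below [|y|^2]. *)
Lemma SymPos_open : open (@SymPos R n).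
Proof.
rewrite openE => S S0; have [L [Lt Ld SE]] := SymPos_cholesky S0.
have Lu := trig_posdiag_unitmx Lt Ld.
pose M := invmx L.
have cW i j : (fun T : Sym => sym_coord i j (act M (T - S))) @ S --> (0 : R).
  rewrite -[X in _ --> X](linear0 (sym_coord i j \o act M)) -[X in _ --> _ X](subrr S).
  apply: (@continuous_comp _ _ _ (fun T : Sym => T - S) (sym_coord i j \o act M)).
    by apply: cvgB; [exact: cvg_id|exact: cvg_cst].
  exact: sym_linear_continuous.
(* With entries below [1/(n+1)] and [|y_i y_j| <= (y_i^2 + y_j^2)/2], the perturbation is at most
   [n/(n+1)] times [|y|^2], a factor strictly below 1. *)
have e0 : 0 < (n.+1%:R : R)^-1 by rewrite invr_gt0.
near=> T.
have WT i j : `|sym_coord i j (act M (T - S))| < n.+1%:R^-1.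
  move: i j; near: T; apply: filter_forall => i; apply: filter_forall => j.
  by have /cvgr0_norm_lt := cW i j; exact.
move=> x x0; have [y yE] : exists y, y = L^T *m x by eexists.
pose W : 'M[R]_n := act M (T - S).
have xE : x = M^T *m y by rewrite yE mulmxA -trmx_mul mulmxV// trmx1 mul1mx.
have y0 : y != 0 by apply: contra x0 => /eqP z; rewrite xE z mulmx0.
have MSM : M *m S *m M^T = 1%:M.
  by rewrite SE /M mulmxA mulVmx// mul1mx -trmx_mul mulVmx// trmx1.
have WE : M *m T *m M^T = 1%:M + W.
  have -> : W = \val (act M T - act M S) by rewrite /W linearB.
  by rewrite raddfB/= MSM addrC subrK.
have TE : x^T *m T *m x = y^T *m y + y^T *m W *m y.
  transitivity (y^T *m (M *m T *m M^T) *m y); last by rewrite WE mulmxDr mulmx1 mulmxDl.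
  by rewrite {1 2}xE trmx_mul trmxK !mulmxA.
rewrite TE mxE mulmx_tr_colE -mulmxA mulmx_tr_colE -big_split/=.
under eq_bigr do rewrite mxE mulr_sumr.
pose c : R := \sum_i y i 0 ^+ 2.
have c0 : 0 < c.
  rewrite lt_neqAle sumr_ge0 => [|i _]; last exact: sqr_ge0.
  rewrite andbT eq_sym; apply: contra y0; rewrite psumr_eq0 => [/allP h|i _]; last exact: sqr_ge0.
  apply/eqP/colP => i; have /= := h i (mem_index_enum _).
  by rewrite sqrf_eq0 => /eqP ->; rewrite mxE.
rewrite big_split/=.
have -> : \sum_i y i 0 * y i 0 = c by apply: eq_bigr => i _; rewrite expr2.
have : - (n%:R / n.+1%:R * c) <= \sum_i \sum_j y i 0 * (W i j * y j 0).
  have -> : - (n%:R / n.+1%:R * c) =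
      \sum_i \sum_j - (n.+1%:R^-1 * ((y i 0 ^+ 2 + y j 0 ^+ 2) / 2)).
    transitivity (- (n.+1%:R^-1 * (\sum_i \sum_j (y i 0 ^+ 2 + y j 0 ^+ 2) / 2))).
      rewrite mulrAC mulrC; congr (- (_ * _)).
      under eq_bigr do rewrite -mulr_suml big_split/= sumr_const card_ord.
      rewrite -mulr_suml big_split/= sumrMnl sumr_const card_ord -/c -mulrnDl.
      by rewrite -(mulr_natl (c + c) n) -mulrA -mulr2n -(mulr_natr c 2) mulfK// pnatr_eq0.
    rewrite mulr_sumr -sumrN; apply: eq_bigr => i _.
    by rewrite mulr_sumr -sumrN.
  apply: ler_sum => i _; apply: ler_sum => j _.
  rewrite [leRHS]mulrCA lerNl -mulNr; apply: le_trans (ler_norm _) _.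
  rewrite normrM normrN; apply: ler_pM => //; first exact: (ltW (WT i j)).
  have := sqr_ge0 (y i 0 - y j 0); have := sqr_ge0 (y i 0 + y j 0).
  rewrite !sqrrD sqrrN mulrN; case: (ger0P (y i 0 * y j 0)); lra.
move=> h; apply: lt_le_trans (lerD (lexx c) h).
by rewrite subr_gt0 gtr_pMl// ltr_pdivrMr// mul1r ltr_nat.
Unshelve. all: by end_near. Qed.

End SymTopology.

(** * The canonical connection *)

Section InvariantTensors.
Context {R : realType} {n : nat}.
Local Notation Sym := (Sym R n).
Local Notation U := (@SymPos R n).

Lemma scalar_sym_sumE (f : Sym -> R) A : scalar f ->
  f A = \sum_i \sum_j sym_coord i j A * f (sym_base i j).
Proof.
move=> sf; pose L : {linear Sym -> R} :=
  HB.pack f (GRing.isLinear.Build R Sym R *:%R f sf).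
exact: (sym_linear_sumE L).
Qed.

Lemma scalar_subr (f : Sym -> R) A B : scalar f -> f (A - B) = f A - f B.
Proof. by move=> sf; rewrite addrC -scaleN1r sf mulN1r addrC. Qed.

(* The product rule for the evaluation pairing of a family of linear forms with
   a family of vectors. *)
Lemma derive_scalar_family (T : normedModType R) (F : T -> Sym -> R) (X : T -> Sym)
    (p v : T) :
  (\near p, scalar (F p)) -> (forall A, differentiable (F^~ A) p) ->
  differentiable X p ->
  differentiable (fun q => F q (X q)) p /\
  'D_v (fun q => F q (X q)) p = 'D_v (fun q => F q (X p)) p + F p ('D_v X p).
Proof.
move=> sF dF dX.
have Fp := nbhs_singleton sF.
have dXij i j : differentiable (fun q => sym_coord i j (X q)) p.
  apply: (@differentiable_comp _ _ _ _ X (sym_coord i j)) => //.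
  exact/linear_differentiable/sym_coord_continuous.
have FE (Y : T -> Sym) :
    \near p, (\sum_i \sum_j ((fun q => sym_coord i j (Y q)) * F^~ (sym_base i j))) p = F p (Y p).
  near=> q; rewrite fct_sumE; under eq_bigr do rewrite fct_sumE.
  by rewrite (scalar_sym_sumE (Y q))//; near: q.
have dP (Y : T -> Sym) (dY : forall i j, differentiable (fun q => sym_coord i j (Y q)) p) i j :
    differentiable ((fun q => sym_coord i j (Y q)) * F^~ (sym_base i j)) p.
  exact: differentiableM.
have dS (Y : T -> Sym) (dY : forall i j, differentiable (fun q => sym_coord i j (Y q)) p) :
    'D_v (fun q => F q (Y q)) p = \sum_i \sum_j
    (sym_coord i j (Y p) * 'D_v (F^~ (sym_base i j)) p
     + F p (sym_base i j) * 'D_v (fun q => sym_coord i j (Y q)) p).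
  rewrite -(near_eq_derive v (FE Y)) derive_sum => [|i].
    apply: eq_bigr => i _; rewrite derive_sum => [|j].
      by apply: eq_bigr => j _; rewrite deriveM//; exact: diff_derivable.
    by apply: diff_derivable; exact: dP.
  by apply: diff_derivable; apply: differentiable_sum => j; exact: dP.
split.
  apply: near_eq_differentiable (FE X) _.
  by apply: differentiable_sum => i; apply: differentiable_sum => j; exact: dP.
rewrite (dS X dXij) (dS (fun=> X p)) => [|i j]; last exact: differentiable_cst.
rewrite (scalar_sym_sumE ('D_v X p) Fp) -big_split/=; apply: eq_bigr => i _.
rewrite -big_split/=; apply: eq_bigr => j _.
rewrite (derive_cst (sym_coord i j (X p))) mulr0 addr0 [F p _ * _]mulrC; congr (_ + _ * _).
rewrite deriveE// (@diff_comp _ _ _ _ X (sym_coord i j))//=; last first.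
  exact/linear_differentiable/sym_coord_continuous.
by rewrite diff_sym_linear deriveE.
Unshelve. all: by end_near. Qed.

Fact symz_subproof (M : 'M[R]_n) : 2^-1 *: (M + M^T) \in @Defs.is_sym R n.
Proof. by rewrite inE linearZ/= raddfD/= trmxK addrC. Qed.

Definition symz (M : 'M[R]_n) : Sym := MkSym (symz_subproof M).

Lemma symz_id (A : Sym) : symz A = A.
Proof.
apply: val_inj; rewrite /= sym_trmx -mulr2n -(scaler_nat 2 (A : 'M[R]_n)) scalerA.
by rewrite mulVf ?scale1r// pnatr_eq0.
Qed.

(** The curve is quadratic in [t], with linear term [(K A + A K^T)/2]. The parameter [t/2] supplies
    the half that [symz] contains, so [K = V S^-1] moves [S] with velocity exactly [V]. *)
Lemma act_curve (K : 'M[R]_n) (A : Sym) :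
  let c := fun t : R => act (1%:M + (t / 2) *: K) A in
  [/\ c 0 = A, differentiable c 0 & 'D_1 c 0 = symz (K *m A)].
Proof.
pose a := symz (K *m A); pose b := act (2^-1 *: K) A.
have cE : (fun t : R => act (1%:M + (t / 2) *: K) A) =
          (fun t => A + t *: a + (t ^+ 2) *: b).
  apply/funext => t; apply: val_inj; rewrite [RHS]raddfD [X in _ = X + _]raddfD /=.
  have tK (s : R) : (s *: K)^T = s *: K^T by rewrite linearZ.
  have -> : (1%:M + (t / 2) *: K)^T = 1%:M + (t / 2) *: K^T.
    by rewrite raddfD/= trmx1 tK.
  rewrite tK !mulmxDl !mulmxDr !(mul1mx, mulmx1) trmx_mul sym_trmx.
  rewrite -!scalemxAl -!scalemxAr.
  move: (K *m A *m K^T) (K *m A) ((A : 'M[R]_n) *m K^T) (A : 'M[R]_n) => M1 M2 M3 M4.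
  by apply/matrixP => i j; rewrite !mxE; field.
have [f1 [d1 D1 E1]] : exists f1 : R -> Sym,
    [/\ differentiable f1 0, 'D_1 f1 0 = a & forall t, f1 t = t *: a].
  exists ( *:%R^~ a); split=> //.
  by rewrite deriveE ?diff_val ?scale1r//; exact: differentiableZl.
have [f2 [d2 D2 E2]] : exists f2 : R -> Sym,
    [/\ differentiable f2 0, 'D_1 f2 0 = 0 & forall t, f2 t = t ^+ 2 *: b].
  have dX : differentiable (fun t : R => t ^+ 2) 0 by exact: (@differentiableX _ _ id 1).
  have dXb : differentiable (fun t : R => t ^+ 2 *: b) 0 by exact: differentiableZl.
  exists (fun t => t ^+ 2 *: b); split=> //.
  rewrite deriveE//.
  by rewrite (diffZl _ dX) (@diffX _ _ id 1 0)//= expr1 mulr0 !scale0r.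
have {}cE : (fun t : R => act (1%:M + (t / 2) *: K) A) = cst A + f1 + f2.
  by rewrite cE; apply/funext => t; rewrite !fctE E1 E2.
have d0 : differentiable (cst A : R -> Sym) 0 by exact: differentiable_cst.
have d01 := differentiableD d0 d1.
rewrite /= cE; split.
- by apply: val_inj; rewrite /= mul0r scale0r addr0 trmx1 mulmx1 mul1mx.
- exact: differentiableD.
- rewrite (deriveD (diff_derivable d01) (diff_derivable d2)) D2 addr0.
  by rewrite (deriveD (diff_derivable d0) (diff_derivable d1)) D1 derive_cst add0r.
Qed.

Lemma act_curve_unitmx (K : 'M[R]_n) :
  \forall t \near (0 : R), 1%:M + (t / 2) *: K \in unitmx.
Proof.
pose f (t : R) : 'M[R]_n := 1%:M + (t / 2) *: K.
have sf : smooth_mx [set: R] f.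
  apply: (smooth_mxD openT); first exact: smooth_mx_cst.
  apply: (smooth_mxZ openT); last exact: smooth_mx_cst.
  apply: (smooth_onM openT); last exact: smooth_on_cst.
  by move=> k; apply: (C_on_linear openT (L := idfun)) => // ?; exact: cvg_id.
have /(_ 0%N 0 I) cf := smooth_on_det openT sf.
have d0 : \det (f 0) != 0 by rewrite /f mul0r scale0r addr0 det1 oner_neq0.
near=> t; rewrite unitmxE unitfE -/(f t); near: t.
exact: cvgr_neq0 cf d0.
Unshelve. all: by end_near. Qed.

(** Minus the Christoffel symbol of the canonical connection. *)
Definition gam (S V A : Sym) : Sym := symz (V *m invmx S *m A).

Lemma differentiable_curve (T : normedModType R) (f : Sym -> R) (s : T -> Sym) (p v : T) :
  smooth_on U f -> U (s p) -> differentiable s p ->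
  differentiable (f \o s) p /\ 'D_v (f \o s) p = 'D_('D_v s p) f (s p).
Proof.
move=> sf Us ds; have df := smooth_on_differentiable sf Us.
split; first exact: differentiable_comp.
rewrite deriveE; last exact: differentiable_comp.
by rewrite diff_comp//= (deriveE _ df) (deriveE _ ds).
Qed.

Lemma near_SymPos_curve (T : normedModType R) (s : T -> Sym) (p : T) :
  U (s p) -> differentiable s p -> \near p, U (s p).
Proof.
move=> Us /differentiable_continuous cs; apply: (cs U).
by apply: open_nbhs_nbhs; split=> //; exact: SymPos_open.
Qed.

Section CubicForm.
Variable C : Sym -> Sym -> Sym -> Sym -> R.
Hypothesis C3 : S3 U C.

Lemma S3_scalar1 S B D : U S -> scalar (fun A => C S A B D).
Proof. by move: C3 => [_ + _ _ _] US; exact. Qed.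

Lemma S3_sym12 S A B D : U S -> C S A B D = C S B A D.
Proof. by move: C3 => [_ _ + _ _] US; exact. Qed.

Lemma S3_sym23 S A B D : U S -> C S A B D = C S A D B.
Proof. by move: C3 => [_ _ _ + _] US; exact. Qed.

Lemma S3_smooth A B D : smooth_on U (fun S => C S A B D).
Proof. by move: C3 => [_ _ _ _ +]; exact. Qed.

Lemma S3_scalar2 S A D : U S -> scalar (fun B => C S A B D).
Proof.
move=> US; have -> : (fun B => C S A B D) = (fun B => C S B A D).
  by apply/funext => B; exact: S3_sym12.
exact: S3_scalar1.
Qed.

Lemma S3_scalar3 S A B : U S -> scalar (fun D => C S A B D).
Proof.
move=> US; have -> : C S A B = (fun D => C S A D B).
  by apply/funext => D; exact: S3_sym23.
exact: S3_scalar2.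
Qed.

Lemma derive_S3 (T : normedModType R) (s X Y Z : T -> Sym) (p v : T) :
  U (s p) -> differentiable s p -> differentiable X p -> differentiable Y p ->
  differentiable Z p ->
  'D_v (fun q => C (s q) (X q) (Y q) (Z q)) p =
  'D_('D_v s p) (fun S => C S (X p) (Y p) (Z p)) (s p) +
  C (s p) ('D_v X p) (Y p) (Z p) + C (s p) (X p) ('D_v Y p) (Z p) +
  C (s p) (X p) (Y p) ('D_v Z p).
Proof.
move=> Us ds dX dY dZ; have nU := near_SymPos_curve Us ds.
have dC A B D := differentiable_curve v (S3_smooth A B D) Us ds.
have n3 A B : \near p, scalar (fun D => C (s p) A B D).
  by apply: filterS nU => q; exact: S3_scalar3.
have n2 A : \near p, scalar (fun B => C (s p) A B (Z p)).
  by apply: filterS nU => q; exact: S3_scalar2.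
have n1 : \near p, scalar (fun A => C (s p) A (Y p) (Z p)).
  by apply: filterS nU => q; exact: S3_scalar1.
(* The arguments are made variable one at a time, [Z], then [Y], then [X]; the differentiability
   obtained at each stage is the hypothesis of the next. *)
have H3 A B := derive_scalar_family v (n3 A B) (fun D => (dC A B D).1) dZ.
have H2 A := derive_scalar_family v (n2 A) (fun B => (H3 A B).1) dY.
have H1 := derive_scalar_family v n1 (fun A => (H2 A).1) dX.
rewrite H1.2 (H2 (X p)).2 (H3 (X p) (Y p)).2 -(dC _ _ _).2 /=.
by rewrite -!addrA; congr (_ + _); rewrite addrA addrC [X in _ + X]addrC.
Qed.

(* Differentiate the invariance of [C] along [h t = 1 + (t/2) V S^-1], which
   moves [S] with velocity [V] and each argument [A] with velocity [gam S V A]. *)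
Lemma invariant_S3_parallel S V A B D : G_invariant3 C -> U S ->
  'D_V (fun S' => C S' A B D) S =
  - (C S (gam S V A) B D + C S A (gam S V B) D + C S A B (gam S V D)).
Proof.
move=> invC US; pose K := V *m invmx S; pose h (t : R) := 1%:M + (t / 2) *: K.
have [s0 ds Ds] := act_curve K S; have [a0 dA DA] := act_curve K A.
have [b0 dB DB] := act_curve K B; have [d0 dD DD] := act_curve K D.
have Us : U (act (h 0) S) by rewrite s0.
have D0 : 'D_(1 : R) (fun t : R => C (act (h t) S) (act (h t) A) (act (h t) B) (act (h t) D)) 0 = 0.
  transitivity ('D_(1 : R) (cst (C S A B D)) (0 : R)); last exact: derive_cst.
  apply: near_eq_derive.
  near=> t; rewrite -[RHS](invC (h t) _ S US) ?diff_sym_linear//.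
  by near: t; exact: act_curve_unitmx.
have := derive_S3 (1 : R) Us ds dA dB dD; rewrite D0 Ds DA DB DD /h s0 a0 b0 d0 /K.
rewrite -mulmxA mulVmx ?SymPos_unitmx// mulmx1 symz_id => /esym/eqP.
by rewrite -!addrA addr_eq0 ?addrA => /eqP.
Unshelve. all: by end_near. Qed.

End CubicForm.

Section Metric.
Variable g : Sym -> Sym -> Sym -> R.
Hypothesis gR : riemannian_metric U g.

Lemma metric_scalar1 S B : U S -> scalar (fun A => g S A B).
Proof. by move: gR => [+ _ _ _] US; exact. Qed.

Lemma metric_sym S A B : U S -> g S A B = g S B A.
Proof. by move: gR => [_ + _ _] US; exact. Qed.

Lemma metric_smooth A B : smooth_on U (fun S => g S A B).
Proof. by move: gR => [_ _ _ +]; exact. Qed.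

Lemma metric_scalar2 S A : U S -> scalar (fun B => g S A B).
Proof.
move=> US; have -> : g S A = (fun B => g S B A).
  by apply/funext => B; exact: metric_sym.
exact: metric_scalar1.
Qed.

Lemma derive_metric (T : normedModType R) (s X Y : T -> Sym) (p v : T) :
  U (s p) -> differentiable s p -> differentiable X p -> differentiable Y p ->
  'D_v (fun q => g (s q) (X q) (Y q)) p =
  'D_('D_v s p) (fun S => g S (X p) (Y p)) (s p) +
  g (s p) ('D_v X p) (Y p) + g (s p) (X p) ('D_v Y p).
Proof.
move=> Us ds dX dY; have nU := near_SymPos_curve Us ds.
have dC A B := differentiable_curve v (metric_smooth A B) Us ds.
have n2 A : \near p, scalar (fun B => g (s p) A B).
  by apply: filterS nU => q; exact: metric_scalar2.
have n1 : \near p, scalar (fun A => g (s p) A (Y p)).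
  by apply: filterS nU => q; exact: metric_scalar1.
have H2 A := derive_scalar_family v (n2 A) (fun B => (dC A B).1) dY.
have H1 := derive_scalar_family v n1 (fun A => (H2 A).1) dX.
by rewrite H1.2 (H2 (X p)).2 -(dC _ _).2 /= addrAC.
Qed.

(** The argument for cubic forms again: along [1 + (t/2) V S^-1], the metric of the transported
    vectors is constant, so the product rule sums to 0. *)
Lemma invariant_metric_parallel S V A B : G_invariant2 g -> U S ->
  'D_V (fun S' => g S' A B) S = - (g S (gam S V A) B + g S A (gam S V B)).
Proof.
move=> invg US; pose K := V *m invmx S; pose h (t : R) := 1%:M + (t / 2) *: K.
have [s0 ds Ds] := act_curve K S; have [a0 dA DA] := act_curve K A.
have [b0 dB DB] := act_curve K B.
have Us : U (act (h 0) S) by rewrite s0.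
have D0 : 'D_(1 : R) (fun t : R => g (act (h t) S) (act (h t) A) (act (h t) B)) 0 = 0.
  transitivity ('D_(1 : R) (cst (g S A B)) (0 : R)); last exact: derive_cst.
  apply: near_eq_derive.
  near=> t; rewrite -[RHS](invg (h t) _ S US) ?diff_sym_linear//.
  by near: t; exact: act_curve_unitmx.
have := derive_metric (1 : R) Us ds dA dB; rewrite D0 Ds DA DB /h s0 a0 b0 /K.
rewrite -mulmxA mulVmx ?SymPos_unitmx// mulmx1 symz_id => /esym/eqP.
by rewrite -!addrA addr_eq0 ?addrA => /eqP.
Unshelve. all: by end_near. Qed.

End Metric.

Section Connection.

Lemma sym_ext (A B : Sym) : (forall i j, sym_coord i j A = sym_coord i j B) -> A = B.
Proof. by move=> AB; apply: val_inj; apply/matrixP => i j; exact: AB. Qed.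

Lemma sym_coord_derive (T : normedModType R) (X : T -> Sym) (p v : T) i j :
  differentiable X p ->
  sym_coord i j ('D_v X p) = 'D_v (fun q => sym_coord i j (X q)) p.
Proof.
move=> dX; have dc := @linear_differentiable _ _ _ (sym_coord i j) (X p)
  (@sym_coord_continuous _ _ i j).
rewrite (deriveE _ dX) (deriveE _ (differentiable_comp dX dc)).
by rewrite (diff_comp dX dc) /= diff_sym_linear.
Qed.

Lemma symz_linear : linear symz.
Proof.
move=> a M N; apply: val_inj => /=.
rewrite linearP/= scalerA mulrC -scalerA -scalerDr; congr (_ *: _).
by rewrite scalerDr addrACA.
Qed.

HB.instance Definition _ := GRing.isLinear.Build R 'M[R]_n Sym *:%R symz symz_linear.

Lemma symz_trmx (M : 'M[R]_n) : symz M^T = symz M.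
Proof. by apply: val_inj; rewrite /= trmxK addrC. Qed.

Lemma gamC S V A : gam S V A = gam S A V.
Proof.
rewrite /gam -[LHS]symz_trmx !trmx_mul trmx_inv !sym_trmx mulmxA //.
Qed.

Lemma gamPr S V a A B : gam S V (a *: A + B) = a *: gam S V A + gam S V B.
Proof. by rewrite /gam -linearP scalemxAr -mulmxDr. Qed.

Lemma gamPl S a V W A : gam S (a *: V + W) A = a *: gam S V A + gam S W A.
Proof. by rewrite !(gamC S _ A) gamPr. Qed.

Lemma smooth_on_sym_mx (f : Sym -> Sym) :
  smooth_mx U (fun S => f S : 'M[R]_n) -> smooth_on U f.
Proof. by move=> sf; apply: (smooth_on_sym SymPos_open) => i j; exact: sf. Qed.

Lemma smooth_sym_mx (f : Sym -> Sym) :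
  smooth_on U f -> smooth_mx U (fun S => f S : 'M[R]_n).
Proof. by move=> sf i j; exact: (smooth_on_sym_coord i j SymPos_open sf). Qed.

Lemma smooth_mx_invS : smooth_mx U (fun S : Sym => invmx S).
Proof.
apply: (smooth_mx_inv SymPos_open) => [S|i j k]; first exact: SymPos_unitmx.
by apply: (C_on_linear SymPos_open (L := sym_coord i j)); exact: sym_coord_continuous.
Qed.

Lemma smooth_on_gam (X Y : Sym -> Sym) : smooth_on U X -> smooth_on U Y ->
  smooth_on U (fun S => gam S (X S) (Y S)).
Proof.
move=> /smooth_sym_mx sX /smooth_sym_mx sY; have oU := @SymPos_open R n.
have sP := smooth_mxM oU (smooth_mxM oU sX smooth_mx_invS) sY.
apply: smooth_on_sym_mx; apply: (smooth_mxZ oU); first exact: smooth_on_cst.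
apply: (smooth_mxD oU) => // i j; under eq_fun do rewrite mxE; exact: sP.
Qed.

Lemma smooth_on_symB (X Y : Sym -> Sym) : smooth_on U X -> smooth_on U Y ->
  smooth_on U (fun S => X S - Y S).
Proof.
have oU := @SymPos_open R n; move=> sX sY; apply: (smooth_onD oU) => //.
by apply: (smooth_on_comp_linear oU (L := -%R)) => //; exact: sym_linear_continuous.
Qed.

(** [smooth_on] controls derivatives in fixed directions only; expanding the moving direction [X S]
    along the fixed [sym_base i j] reduces to those. *)
Lemma smooth_on_derive_along (X Y : Sym -> Sym) : smooth_on U X -> smooth_on U Y ->
  smooth_on U (fun S => 'D_(X S) Y S).
Proof.
have oU := @SymPos_open R n; move=> sX sY.
apply: (@smooth_on_eq _ _ _ oU _
  (fun S => \sum_i \sum_j sym_coord i j (X S) *: 'D_(sym_base i j) Y S)).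
  move=> S US; have dY := smooth_on_differentiable sY US.
  rewrite (deriveE _ dY) [RHS]sym_linear_sumE.
  by under eq_bigr do under eq_bigr do rewrite (deriveE _ dY).
apply: (smooth_on_sum oU) => i _; apply: (smooth_on_sum oU) => j _.
apply: (smooth_on_sym oU) => k l.
under eq_fun do rewrite linearZ.
apply: (smooth_onM oU); first exact: smooth_on_sym_coord.
by apply: (smooth_on_sym_coord _ _ oU); exact: smooth_on_derive.
Qed.

(* The canonical connection of the symmetric space [GL(n)/O(n)]. *)
Definition conn (X Y : Sym -> Sym) : Sym -> Sym :=
  fun S => 'D_(X S) Y S - gam S (X S) (Y S).

Lemma conn_affine : affine_connection U conn.
Proof.
have oU := @SymPos_open R n.
split=> [X Y sX sY|f X X' Y sf sX sX' sY S US|X Y Y' sX sY sY' S US|f X Y sf sX sY S US].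
- by apply: smooth_on_symB; [exact: smooth_on_derive_along|exact: smooth_on_gam].
- rewrite /conn gamPl !(deriveE _ (smooth_on_differentiable sY US)) linearP.
  by rewrite scalerBr opprD addrACA.
- have dY := smooth_on_differentiable sY US; have dY' := smooth_on_differentiable sY' US.
  rewrite /conn deriveD; [|exact: diff_derivable|exact: diff_derivable].
  have := gamPr S (X S) 1 (Y S) (Y' S); rewrite !scale1r => ->.
  by rewrite opprD addrACA.
- have dY := smooth_on_differentiable sY US; have df := smooth_on_differentiable sf US.
  rewrite /conn; have := gamPr S (X S) (f S) (Y S) 0; rewrite !addr0 => ->.
  have -> : gam S (X S) 0 = 0 by rewrite /gam /= mulmx0 linear0.
  (* The Leibniz rule is checked in each coordinate, where it is the product rule for real
     functions. *)
  rewrite addr0 scalerBr addrA; congr (_ - _); apply: sym_ext => i j.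
  have sfY : smooth_on U (fun q => f q *: Y q).
    apply: (smooth_on_sym oU) => k l; under eq_fun do rewrite linearZ.
    by apply: (smooth_onM oU) => //; exact: smooth_on_sym_coord.
  rewrite sym_coord_derive; last exact: smooth_on_differentiable sfY US.
  under eq_fun do rewrite linearZ.
  have dYij : differentiable (fun q => sym_coord i j (Y q)) S.
    by apply: smooth_on_differentiable US; exact: smooth_on_sym_coord.
  rewrite deriveM; [|exact: diff_derivable|exact: diff_derivable].
  by rewrite raddfD /= !linearZ /= -sym_coord_derive// addrC [X in X + _]mulrC.
Qed.

Lemma conn_torsion_free : torsion_free U conn.
Proof.
move=> X Y sX sY S US; rewrite /conn /lie_bracket (gamC S (Y S)).
by rewrite opprB addrA subrK.
Qed.

Lemma conn_metric_compatible g : riemannian_metric U g -> G_invariant2 g ->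
  metric_compatible U g conn.
Proof.
move=> gR invg X Y Z sX sY sZ S US.
rewrite (derive_metric gR (s := id))//; last 2 first.
- exact: smooth_on_differentiable sY US.
- exact: smooth_on_differentiable sZ US.
rewrite derive_id (invariant_metric_parallel gR)// /conn.
rewrite (scalar_subr _ _ (metric_scalar1 gR _ US)).
rewrite (scalar_subr _ _ (metric_scalar2 gR _ US)); ring.
Qed.

Lemma conn_levi_civita g : riemannian_metric U g -> G_invariant2 g ->
  levi_civita U g conn.
Proof.
move=> gR invg; split; [exact: conn_affine|exact: conn_torsion_free|].
exact: conn_metric_compatible.
Qed.

(** Two cancellations: the derivatives of [X], [Y], [Z] against the derivative part of [conn], and
    the derivative of [C] in the base point, known from invariance, against the [gam] part. *)
Lemma conn_covariant_derivative0 C X Y Z W S : S3 U C -> G_invariant3 C ->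
  smooth_on U X -> smooth_on U Y -> smooth_on U Z -> U S ->
  covariant_derivative conn C W X Y Z S = 0.
Proof.
move=> C3 invC sX sY sZ US; rewrite /covariant_derivative.
rewrite (derive_S3 C3 (s := id))//; last 3 first.
- exact: smooth_on_differentiable sX US.
- exact: smooth_on_differentiable sY US.
- exact: smooth_on_differentiable sZ US.
rewrite derive_id (invariant_S3_parallel C3)// /conn.
rewrite (scalar_subr _ _ (S3_scalar1 C3 _ _ US)).
rewrite (scalar_subr _ _ (S3_scalar2 C3 _ _ US)).
rewrite (scalar_subr _ _ (S3_scalar3 C3 _ _ US)); ring.
Qed.

Lemma invariant_conjugate_symmetric g C : statistical_structure U g C ->
  G_invariant2 g -> G_invariant3 C -> conjugate_symmetric U g C.
Proof.
move=> [gR C3] invg invC; exists conn; first exact: conn_levi_civita.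
move=> W X Y Z sW sX sY sZ S US.
by split; rewrite !conn_covariant_derivative0.
Qed.

Lemma S3_CS_GE g : riemannian_metric U g -> G_invariant2 g ->
  S3_CS_G g = @S3_G R n.
Proof.
move=> gR invg; apply/seteqP; split=> [C [[[_ C3] _] invC]|C [C3 invC]]; first by split.
by split=> //; split; [|exact: invariant_conjugate_symmetric].
Qed.

End Connection.

End InvariantTensors.

(** * Invariant cubic forms and symmetric polynomials *)

Section PermutationInvariants.
Context {R : numDomainType} {n : nat} (c : 'I_n -> 'I_n -> 'I_n -> R).
Hypothesis c12 : forall i j k, c i j k = c j i k.
Hypothesis c23 : forall i j k, c i j k = c i k j.
Hypothesis c_perm : forall (s : {perm 'I_n}) i j k, c (s i) (s j) (s k) = c i j k.

Lemma perm_invariant1 i i' : c i i i = c i' i' i'.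
Proof. by rewrite -(c_perm (tperm i i')) tpermL. Qed.

Lemma perm_invariant2 i k i' k' : i != k -> i' != k' -> c i i k = c i' i' k'.
Proof.
move=> ik ik'; rewrite -(c_perm (tperm i i')) tpermL.
have : tperm i i' k != i' by rewrite -{2}(tpermL i i') (inj_eq perm_inj) eq_sym.
move: (tperm i i' k) => l li; rewrite -(c_perm (tperm l k')) tpermL.
by rewrite tpermD// eq_sym.
Qed.

(** Three successive transpositions bring the indices to [i'], [j'], [k'], each fixing those already
    in place. *)
Lemma perm_invariant3 i j k i' j' k' : i != j -> i != k -> j != k ->
  i' != j' -> i' != k' -> j' != k' -> c i j k = c i' j' k'.
Proof.
move=> ij ik jk; rewrite ![_ == j']eq_sym ![_ == k']eq_sym => ji' ki' kj'.
rewrite -(c_perm (tperm i i')) tpermL.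
have ti x : i != x -> tperm i i' x != i'.
  by move=> ix; rewrite -{2}(tpermL i i') (inj_eq perm_inj) eq_sym.
have : tperm i i' j != tperm i i' k by rewrite (inj_eq perm_inj).
move: (tperm i i' j) (tperm i i' k) (ti _ ij) (ti _ ik) => l m li mi lm.
rewrite -(c_perm (tperm l j')) tpermL (tpermD li ji').
have ml : tperm l j' m != j' by rewrite -{2}(tpermL l j') (inj_eq perm_inj) eq_sym.
have mi' : tperm l j' m != i' by rewrite -(tpermD li ji') (inj_eq perm_inj).
move: (tperm l j' m) ml mi' => m' ml mi'.
by rewrite -(c_perm (tperm m' k')) tpermL !tpermD.
Qed.

(** A triangular system: the coefficients with three, two and one distinct indices are [u], [u + v]
    and [u + 3 v + w]. When no such index pattern exists, the default value 0 of the [pick] gives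
    the stated normalization. *)
Lemma perm_invariant_decomp : exists u v w : R,
  [/\ (n < 3)%N -> u = 0, (n < 2)%N -> v = 0
    & forall i j k, c i j k =
      u + v * ((j == k)%:R + (i == k)%:R + (i == j)%:R) + w * ((i == j) && (j == k))%:R].
Proof.
pose u := if [pick t : 'I_n * 'I_n * 'I_n |
    [&& t.1.1 != t.1.2, t.1.1 != t.2 & t.1.2 != t.2]] is Some t
  then c t.1.1 t.1.2 t.2 else 0.
pose v := if [pick t : 'I_n * 'I_n | t.1 != t.2] is Some t
  then c t.1 t.1 t.2 - u else 0.
pose w := if [pick i : 'I_n] is Some i then c i i i - u - v * 3 else 0.
have uE i j k : i != j -> i != k -> j != k -> u = c i j k.
  move=> ij ik jk; rewrite /u; case: pickP => [[[i' j'] k'] /= /and3P[? ? ?]|/(_ (i, j, k))].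
    exact: perm_invariant3.
  by rewrite /= ij ik jk.
have vE i k : i != k -> v = c i i k - u.
  move=> ik; rewrite /v; case: pickP => [[i' k'] /= ik'|/(_ (i, k))]; last by rewrite /= ik.
  by rewrite (perm_invariant2 ik' ik).
have wE i : w = c i i i - u - v * 3.
  rewrite /w; case: pickP => [i' _|/(_ i)//]; by rewrite (perm_invariant1 i' i).
exists u, v, w; split.
- move=> n3; rewrite /u; case: pickP => // -[[i j] k] /= /and3P[ij ik jk].
  have : (#|[set i; j; k]%SET| <= n)%N by rewrite -[X in (_ <= X)%N]card_ord max_card.
  rewrite -finset.setUA cardsU1 cards2 !inE negb_or ij ik jk /= => n3'.
  by have := leq_trans n3' n3; rewrite ltnn.
- move=> n2; rewrite /v; case: pickP => // -[i j] /= ij.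
  have : (#|[set i; j]%SET| <= n)%N by rewrite -[X in (_ <= X)%N]card_ord max_card.
  by rewrite cards2 ij /= => n2'; have := leq_trans n2' n2; rewrite ltnn.
- move=> i j k; have [->|ij] := eqVneq i j; have [<-|jk] := eqVneq j k.
  + by rewrite ?eqxx (wE j) /=; ring.
  + by rewrite ?eqxx ?(negbTE jk) (vE j k jk)/=; ring.
  + have ji : j != i by rewrite eq_sym.
    by rewrite ?eqxx ?(negbTE ij) c12 c23 (vE j i ji)/=; ring.
  + have [ik|ik] := eqVneq i k.
      by rewrite -ik c23 (vE i j ij)/=; ring.
    by rewrite (uE i j k ij ik jk)/=; ring.
Qed.

End PermutationInvariants.

(** * Trace forms invariant under congruence *)

Section CubicForms.
Context {R : realType} {n : nat}.
Local Notation Sym := (Sym R n).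
Local Notation U := (@SymPos R n).
Implicit Types (S X Y Z : Sym) (h : 'M[R]_n).

Fact sym1_subproof : 1%:M \in @Defs.is_sym R n.
Proof. by rewrite inE trmx1. Qed.

Definition sym1 : Sym := MkSym sym1_subproof.

Lemma SymPos_sym1 : U sym1.
Proof.
move=> x x0; rewrite mulmx1 -{2}[x]trmxK mulmx_tr_row_gt0//.
by apply: contra x0 => /eqP h; rewrite -[x]trmxK h trmx0.
Qed.

Lemma actM h k S : act h (act k S) = act (h *m k) S.
Proof. by apply: val_inj; rewrite /= trmx_mul !mulmxA. Qed.

Lemma act1 S : act 1%:M S = S.
Proof. by apply: val_inj; rewrite /= trmx1 mulmx1 mul1mx. Qed.

Lemma actK h S : h \in unitmx -> act h (act (invmx h) S) = S.
Proof. by move=> hu; rewrite actM mulmxV// act1. Qed.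

Lemma act_SymPos h S : h \in unitmx -> U S -> U (act h S).
Proof.
move=> hu US x x0; have y0 : h^T *m x != 0.
  have htu : h^T \in unitmx by rewrite unitmx_tr.
  by apply: contra x0 => /eqP hx; rewrite -(mulKmx htu x) hx mulmx0.
by have := US _ y0; rewrite /= trmx_mul trmxK !mulmxA.
Qed.

Lemma SymPos_orbit S : U S -> exists2 h, h \in unitmx & S = act h sym1.
Proof.
move=> /SymPos_cholesky[L [Lt Ld SE]]; exists L; first exact: trig_posdiag_unitmx.
by apply: val_inj; rewrite /= SE mulmx1.
Qed.

Definition tr1 S X : R := \tr (invmx S *m X).
Definition tr2 S X Y : R := \tr (invmx S *m X *m (invmx S *m Y)).
Definition tr3 S X Y Z : R :=
  \tr (invmx S *m X *m (invmx S *m Y) *m (invmx S *m Z)).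

(** The congruence action becomes a conjugation on [S^-1 X], which is why the traces of products of
    such matrices are invariant. *)
Lemma invmx_act h S X : h \in unitmx -> U S ->
  invmx (act h S) *m act h X = invmx h^T *m (invmx S *m X) *m h^T.
Proof.
move=> hu US; have Su := SymPos_unitmx US; have htu : h^T \in unitmx by rewrite unitmx_tr.
have -> : invmx (act h S) = invmx h^T *m invmx S *m invmx h.
  have MN : (act h S : 'M[R]_n) *m (invmx h^T *m invmx S *m invmx h) = 1%:M.
    by rewrite /= !mulmxA (mulmxK htu) (mulmxK Su) mulmxV.
  have [Mu _] := mulmx1_unit MN.
  by rewrite -[RHS]mul1mx -(mulVmx Mu) -mulmxA MN mulmx1.
by rewrite /= !mulmxA mulmxKV.
Qed.

Lemma mxtrace_conj (g A : 'M[R]_n) : g \in unitmx -> \tr (invmx g *m A *m g) = \tr A.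
Proof. by move=> gu; rewrite mxtrace_mulC !mulmxA mulmxV// mul1mx. Qed.

Lemma conjM (g A B : 'M[R]_n) : g \in unitmx ->
  (invmx g *m A *m g) *m (invmx g *m B *m g) = invmx g *m (A *m B) *m g.
Proof. by move=> gu; rewrite !mulmxA mulmxK. Qed.

Lemma tr1_act h S X : h \in unitmx -> U S -> tr1 (act h S) (act h X) = tr1 S X.
Proof. by move=> hu US; rewrite /tr1 invmx_act// mxtrace_conj ?unitmx_tr. Qed.

Lemma tr2_act h S X Y : h \in unitmx -> U S ->
  tr2 (act h S) (act h X) (act h Y) = tr2 S X Y.
Proof.
by move=> hu US; rewrite /tr2 !invmx_act// conjM ?mxtrace_conj ?unitmx_tr.
Qed.

Lemma tr3_act h S X Y Z : h \in unitmx -> U S ->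
  tr3 (act h S) (act h X) (act h Y) (act h Z) = tr3 S X Y Z.
Proof.
by move=> hu US; rewrite /tr3 !invmx_act// !conjM ?mxtrace_conj ?unitmx_tr.
Qed.

Lemma tr2C S X Y : tr2 S X Y = tr2 S Y X.
Proof. exact: mxtrace_mulC. Qed.

Lemma tr3_rot S X Y Z : tr3 S X Y Z = tr3 S Z X Y.
Proof. by rewrite /tr3 mxtrace_mulC !mulmxA. Qed.

(** Transposition reverses the order of the symmetric factors, and cyclicity of the trace restores
    the alternation of [S^-1] with the arguments. *)
Lemma tr3C S X Y Z : tr3 S X Y Z = tr3 S Y X Z.
Proof.
rewrite tr3_rot /tr3 -mxtrace_tr !trmx_mul trmx_inv !sym_trmx !mulmxA.
by rewrite mxtrace_mulC !mulmxA.
Qed.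

Definition cubic_fun (u v w : R) S X Y Z : R :=
  u * (tr1 S X * tr1 S Y * tr1 S Z) +
  v * (tr1 S X * tr2 S Y Z + tr1 S Y * tr2 S X Z + tr1 S Z * tr2 S X Y) +
  w * tr3 S X Y Z.

Definition cubic (u v w : R) := patch (fun=> 0) U (cubic_fun u v w).

Lemma cubicE u v w S : U S -> cubic u v w S = cubic_fun u v w S.
Proof. by move=> US; rewrite /cubic patchE mem_set. Qed.

Lemma cubic_out u v w S : ~ U S -> cubic u v w S = 0.
Proof. by move=> US; rewrite /cubic patchE memNset. Qed.

Lemma tr1_scalar S : scalar (tr1 S).
Proof. by move=> a X Y; rewrite /tr1 /= mulmxDr -scalemxAr raddfD/= mxtraceZ. Qed.

Lemma tr2_scalar S Y : scalar (fun X => tr2 S X Y).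
Proof.
by move=> a X X'; rewrite /tr2 /= mulmxDr mulmxDl -scalemxAr -scalemxAl raddfD/= mxtraceZ.
Qed.

Lemma tr3_scalar S Y Z : scalar (fun X => tr3 S X Y Z).
Proof.
by move=> a X X'; rewrite /tr3 /= mulmxDr !mulmxDl -scalemxAr -!scalemxAl raddfD/= mxtraceZ.
Qed.

Lemma smooth_mx_invSM X : smooth_mx U (fun S : Sym => invmx S *m X).
Proof. apply: (smooth_mxM SymPos_open) => //; [exact: smooth_mx_invS|exact: smooth_mx_cst]. Qed.

Lemma smooth_tr1 X : smooth_on U (fun S => tr1 S X).
Proof. exact/(smooth_on_mxtrace SymPos_open)/smooth_mx_invSM. Qed.

Lemma smooth_tr2 X Y : smooth_on U (fun S => tr2 S X Y).
Proof.
apply/(smooth_on_mxtrace SymPos_open)/(smooth_mxM SymPos_open); exact: smooth_mx_invSM.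
Qed.

Lemma smooth_tr3 X Y Z : smooth_on U (fun S => tr3 S X Y Z).
Proof.
apply/(smooth_on_mxtrace SymPos_open)/(smooth_mxM SymPos_open); last exact: smooth_mx_invSM.
by apply: (smooth_mxM SymPos_open); exact: smooth_mx_invSM.
Qed.

Lemma cubic_S3_G u v w : S3_G (cubic u v w).
Proof.
have oU := @SymPos_open R n.
split; first split.
- exact: cubic_out.
- move=> S US Y Z a X X'; rewrite cubicE// /cubic_fun.
  by rewrite tr1_scalar !tr2_scalar tr3_scalar; ring.
- by move=> S US X Y Z; rewrite cubicE// /cubic_fun tr3C (tr2C _ X Y); ring.
- move=> S US X Y Z; rewrite cubicE// /cubic_fun.
  by rewrite (tr3_rot S X Z Y) (tr3C S Y X Z) (tr2C _ Y Z); ring.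
- move=> X Y Z; apply: (smooth_on_eq oU (f := fun S => cubic_fun u v w S X Y Z)).
    by move=> S US; rewrite cubicE.
  have sX := smooth_tr1 X; have sY := smooth_tr1 Y; have sZ := smooth_tr1 Z.
  apply: (smooth_onD oU); first apply: (smooth_onD oU).
  + apply: (smooth_onM oU); first exact: smooth_on_cst.
    by apply: (smooth_onM oU) => //; exact: (smooth_onM oU).
  + apply: (smooth_onM oU); first exact: smooth_on_cst.
    apply: (smooth_onD oU); first apply: (smooth_onD oU).
    * by apply: (smooth_onM oU) => //; exact: smooth_tr2.
    * by apply: (smooth_onM oU) => //; exact: smooth_tr2.
    * by apply: (smooth_onM oU) => //; exact: smooth_tr2.
  + apply: (smooth_onM oU); first exact: smooth_on_cst.
    exact: smooth_tr3.
- move=> h hu S US X Y Z; rewrite !diff_sym_linear !cubicE//; last exact: act_SymPos.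
  by rewrite /cubic_fun !tr1_act// !tr2_act// tr3_act.
Qed.

End CubicForms.

(** * Cubic symmetric polynomials and their coefficient families *)

Section CubicPolynomials.
Context {R : realType} {n : nat}.
Local Notation T3 := ('I_n * 'I_n * 'I_n)%type.
Implicit Types (c : 'I_n -> 'I_n -> 'I_n -> R) (t : T3).

Definition triple_mon t : mpoly.multinom n :=
  mpoly.mnm_add (mpoly.mnm_add (mpoly.mnm1 t.1.1) (mpoly.mnm1 t.1.2)) (mpoly.mnm1 t.2).

Lemma mdeg_triple_mon t : mpoly.mdeg (triple_mon t) = 3.
Proof. by rewrite !mpoly.mdegD !mpoly.mdeg1. Qed.

Lemma mnm_sub1 (m : mpoly.multinom n) d : mpoly.mdeg m = d.+1 ->
  exists i m', m = mpoly.mnm_add m' (mpoly.mnm1 i) /\ mpoly.mdeg m' = d.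
Proof.
move=> md; have [i mi] : exists i, mpoly.fun_of_multinom m i != 0%N.
  apply/existsP; apply: contra_eqT md; rewrite negb_exists => /forallP m0.
  by rewrite mpoly.mdegE big1// => i _; apply/eqP; have := m0 i; rewrite negbK.
have mE : mpoly.mnm_add (mpoly.mnm_sub m (mpoly.mnm1 i)) (mpoly.mnm1 i) = m.
  by apply: mpoly.submK; rewrite mpoly.lep1mP.
exists i, (mpoly.mnm_sub m (mpoly.mnm1 i)); split=> //.
by move: md; rewrite -{1}mE mpoly.mdegD mpoly.mdeg1 addn1 => -[].
Qed.

Lemma triple_mon_onto m : mpoly.mdeg m = 3 -> exists t, triple_mon t = m.
Proof.
move=> /mnm_sub1[k [m1 [-> /mnm_sub1[j [m2 [-> /mnm_sub1[i [m3 [-> m30]]]]]]]]].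
have -> : m3 = mpoly.mnm0 by apply/eqP; rewrite -mpoly.mdeg_eq0 m30.
by exists (i, j, k); rewrite /triple_mon mpoly.add0m.
Qed.

Definition cubic_poly c : mpoly.mpoly n R :=
  \sum_t c t.1.1 t.1.2 t.2 *: mpoly.mpolyX R (triple_mon t).

Lemma mcoeff_cubic_poly c m :
  mpoly.mcoeff m (cubic_poly c) = \sum_(t | triple_mon t == m) c t.1.1 t.1.2 t.2.
Proof.
rewrite /cubic_poly raddf_sum /= [RHS]big_mkcond; apply: eq_bigr => t _.
by rewrite mpoly.mcoeffZ mpoly.mcoeffX; case: eqP; rewrite ?mulr1 ?mulr0.
Qed.

Definition perm_triple (s : {perm 'I_n}) t : T3 := (s t.1.1, s t.1.2, s t.2).

(** Written in the form in which [mpoly.mcoeff_sym] produces permuted exponents. *)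
Definition perm_mon (m : mpoly.multinom n) (s : {perm 'I_n}) : mpoly.multinom n :=
  mpoly.Multinom [tuple mpoly.fun_of_multinom m (s i) | i < n].

Lemma perm_tripleK s : cancel (perm_triple s) (perm_triple s^-1%g).
Proof. by move=> [[i j] k]; rewrite /perm_triple/= !permK. Qed.

Lemma perm_tripleVK s : cancel (perm_triple s^-1%g) (perm_triple s).
Proof. by move=> [[i j] k]; rewrite /perm_triple/= !permKV. Qed.

Lemma triple_mon_perm s t : perm_mon (triple_mon (perm_triple s t)) s = triple_mon t.
Proof.
apply/mpoly.mnmP => i; rewrite mpoly.mnmE /triple_mon.
by rewrite !mpoly.mnmDE !mpoly.mnm1E /= !(inj_eq perm_inj).
Qed.

Lemma perm_mon_inj s : injective (perm_mon^~ s).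
Proof.
move=> m1 m2 /mpoly.mnmP e; apply/mpoly.mnmP => i.
by have := e (s^-1%g i); rewrite !mpoly.mnmE permKV.
Qed.

Lemma sum_triple_mon_perm s m (F : T3 -> R) :
  \sum_(t | triple_mon t == perm_mon m s) F t =
  \sum_(t | triple_mon t == m) F (perm_triple s^-1%g t).
Proof.
rewrite (reindex (perm_triple s^-1%g)) /=; last first.
  by exists (perm_triple s) => t _; [exact: perm_tripleVK|exact: perm_tripleK].
apply: eq_bigl => t; rewrite -(inj_eq (@perm_mon_inj s) (triple_mon t)).
by rewrite -{2}(perm_tripleVK s t) triple_mon_perm.
Qed.

Lemma cubic_poly_SP3 c :
  (forall (s : {perm 'I_n}) i j k, c (s i) (s j) (s k) = c i j k) ->
  SP3 (cubic_poly c).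
Proof.
move=> cs; split.
  apply: rpred_sum => t _; apply: rpredZ.
  by rewrite mpoly.dhomogX; apply/eqP; exact: mdeg_triple_mon.
apply/mpoly.issymP => s; apply/mpoly.mpolyP => m.
rewrite mpoly.mcoeff_sym !mcoeff_cubic_poly -/(perm_mon m s) sum_triple_mon_perm.
by apply: eq_bigr => t _; rewrite /= cs.
Qed.

(** Each coefficient of [p] is spread evenly over the ordered triples with the same monomial. Their
    number [mult m] is positive in degree 3, and homogeneity makes the other coefficients 0. *)
Lemma SP3_cubic_poly p : SP3 p -> exists c,
  [/\ forall i j k, c i j k = c j i k, forall i j k, c i j k = c i k j,
      forall (s : {perm 'I_n}) i j k, c (s i) (s j) (s k) = c i j k
    & p = cubic_poly c].
Proof.
move=> [p3 psym]; pose mult m : R := \sum_(t | triple_mon t == m) 1.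
pose d m := mpoly.mcoeff m p / mult m.
exists (fun i j k => d (triple_mon (i, j, k))); split=> [i j k|i j k|s i j k|].
- by rewrite /triple_mon /= [mpoly.mnm_add (mpoly.mnm1 i) _]mpoly.addmC.
- by rewrite /triple_mon /= -!mpoly.addmA [mpoly.mnm_add (mpoly.mnm1 j) _]mpoly.addmC.
- rewrite -(triple_mon_perm s (i, j, k)); set m := triple_mon _; rewrite /d.
  have -> : mpoly.mcoeff (perm_mon m s) p = mpoly.mcoeff m p by exact: mpoly.msym_coeff.
  by rewrite /mult sum_triple_mon_perm.
- apply/mpoly.mpolyP => m; rewrite mcoeff_cubic_poly.
  under eq_bigr => t /eqP tm.
    rewrite -!surjective_pairing tm -[d m]mul1r.
  over.
  rewrite -mulr_suml -/(mult m) /d mulrCA.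
  have [m3|m3] := eqVneq (mpoly.mdeg m) 3%N.
    have [t tm] := triple_mon_onto m3.
    rewrite mulfV ?mulr1//; rewrite gt_eqF// /mult (bigD1 t) ?tm//=.
    by rewrite ltr_pwDl// sumr_ge0.
  have -> : mpoly.mcoeff m p = 0; last by rewrite mul0r.
  by apply: (mpoly.dhomog_nemf_coeff p3).
Qed.

Lemma meval_cubic_poly c (x : 'I_n -> R) :
  mpoly.meval x (cubic_poly c) =
  \sum_i \sum_j \sum_k x i * x j * x k * c i j k.
Proof.
rewrite /cubic_poly raddf_sum pair_bigA pair_bigA /=; apply: eq_bigr => t _.
rewrite mpoly.mevalZ /triple_mon !mpoly.mpolyXD !mpoly.mevalM !mpoly.mevalXU.
by rewrite mulrC.
Qed.

Lemma cubic_poly_linear a c c' :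
  cubic_poly (fun i j k => a * c i j k + c' i j k) = a *: cubic_poly c + cubic_poly c'.
Proof.
rewrite /cubic_poly scaler_sumr -big_split; apply: eq_bigr => t _.
by rewrite /= scalerDl scalerA.
Qed.

End CubicPolynomials.

(** * Classification of the invariant cubic tensors, and the dimension *)

Section Classification.
Context {R : realType} {n : nat}.
Local Notation Sym := (Sym R n).
Local Notation U := (@SymPos R n).
Implicit Types (C : Sym -> Sym -> Sym -> Sym -> R).

Definition diag_coef C (i j k : 'I_n) : R :=
  C sym1 (sym_base i i) (sym_base j j) (sym_base k k).

Lemma sym_base_diag i : sym_base i i = delta_mx i i :> 'M[R]_n.
Proof.
rewrite /= -mulr2n -(scaler_nat 2 (delta_mx i i : 'M[R]_n)) scalerA.
by rewrite mulVf ?scale1r// pnatr_eq0.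
Qed.

Lemma S3_G_act C h S X Y Z : S3_G C -> h \in unitmx -> U S ->
  C (act h S) (act h X) (act h Y) (act h Z) = C S X Y Z.
Proof. by move=> [_ invC] hu US; rewrite -(invC h hu S US) !diff_sym_linear. Qed.

Lemma perm_base (s : {perm 'I_n}) i :
  act (perm_mx s) (sym_base (s i) (s i)) = sym_base i i :> Sym.
Proof.
apply: val_inj; rewrite [RHS]sym_base_diag /act -[LHS]/(_ *m _ *m _) sym_base_diag.
rewrite tr_perm_mx -row_permE -col_permE.
by apply/matrixP => a b; rewrite !mxE !(inj_eq perm_inj).
Qed.

Lemma act_orthogonal_sym1 (Q : 'M[R]_n) : Q *m Q^T = 1%:M -> act Q sym1 = sym1.
Proof. by move=> QQ; apply: val_inj; rewrite /= mulmx1. Qed.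

Lemma diag_coef_perm C (s : {perm 'I_n}) i j k : S3_G C ->
  diag_coef C (s i) (s j) (s k) = diag_coef C i j k.
Proof.
move=> CG; have pu : (perm_mx s : 'M[R]_n) \in unitmx by exact: unitmx_perm.
rewrite /diag_coef -(S3_G_act _ _ _ CG pu SymPos_sym1) !perm_base.
by rewrite act_orthogonal_sym1// tr_perm_mx -perm_mxM mulgV perm_mx1.
Qed.

Lemma scalar_sum (f : Sym -> R) (I : Type) (r : seq I) (x : I -> R) (A : I -> Sym) :
  scalar f -> f (\sum_(i <- r) x i *: A i) = \sum_(i <- r) x i * f (A i).
Proof.
move=> sf; elim: r => [|i r IH]; last by rewrite !big_cons sf IH.
by rewrite !big_nil -[X in f X](subrr 0) (scalar_subr _ _ sf) subrr.
Qed.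

Lemma S3_diag_expand C (x : 'I_n -> R) : S3 U C ->
  let D := \sum_i x i *: sym_base i i in
  C sym1 D D D = \sum_i \sum_j \sum_k x i * x j * x k * diag_coef C i j k.
Proof.
move=> C3 /=; have U1 := @SymPos_sym1 R n.
rewrite (scalar_sum _ _ _ (S3_scalar1 C3 _ _ U1)); apply: eq_bigr => i _.
rewrite (scalar_sum _ _ _ (S3_scalar2 C3 _ _ U1)) mulr_sumr; apply: eq_bigr => j _.
rewrite (scalar_sum _ _ _ (S3_scalar3 C3 _ _ U1)) !mulr_sumr; apply: eq_bigr => k _.
by rewrite !mulrA.
Qed.

Lemma S3_polarization C S X Y Z : S3 U C -> U S ->
  let f := fun A => C S A A A in
  C S X Y Z = (f (X + Y + Z) - f (X + Y) - f (X + Z) - f (Y + Z) + f X + f Y + f Z) / 6.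
Proof.
move=> C3 US /=.
have D1 A A' B E : C S (A + A') B E = C S A B E + C S A' B E.
  by have := S3_scalar1 C3 B E US 1 A A'; rewrite scale1r mul1r.
have D2 A A' B E : C S B (A + A') E = C S B A E + C S B A' E.
  by have := S3_scalar2 C3 B E US 1 A A'; rewrite scale1r mul1r.
have D3 A A' B E : C S B E (A + A') = C S B E A + C S B E A'.
  by have := S3_scalar3 C3 B E US 1 A A'; rewrite scale1r mul1r.
rewrite !(D1, D2, D3).
have s12 := fun A B E => S3_sym12 C3 A B E US.
have s23 := fun A B E => S3_sym23 C3 A B E US.
(* The arguments of every term are sorted in the order [X], [Y], [Z], so that [ring] recognizes
   equal values; the six orderings of [X Y Z] account for the divisor 6. *)
rewrite (s12 Y X X) (s23 X Y X) (s12 Z X X) (s23 X Z X) (s12 Y X Y) (s23 Y Y X) (s12 Y X Y).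
rewrite (s12 Y X Z) (s23 X Z Y) (s12 Z X Y) (s23 X Z Y) (s23 Y Z X) (s12 Y X Z) (s23 Z Y X)
  (s12 Z X Y) (s23 X Z Y) (s12 Z X Z) (s23 Z Z X) (s12 Z X Z) (s12 Z Y Y) (s23 Y Z Y)
  (s12 Z Y Z) (s23 Z Z Y) (s12 Z Y Z).
have n6 : 6 != 0 :> R by rewrite pnatr_eq0.
by apply: (canRL (mulfK n6)); ring.
Qed.

Lemma S3_G_eq C C' : S3_G C -> S3_G C' ->
  (forall x : 'I_n -> R,
    \sum_i \sum_j \sum_k x i * x j * x k * diag_coef C i j k =
    \sum_i \sum_j \sum_k x i * x j * x k * diag_coef C' i j k) -> C = C'.
Proof.
move=> CG CG' h; have [C3 _] := CG; have [C3' _] := CG'.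
have U1 := @SymPos_sym1 R n.
have cube X : C sym1 X X X = C' sym1 X X X.
  have [Q [QQ QD]] := symmetric_orthogonal_diag (sym_trmx X).
  have Qu : Q \in unitmx by case: (mulmx1_unit QQ).
  (* The orthogonal [Q] fixes the base point, so [X] may be replaced by its diagonal form. *)
  rewrite -(S3_G_act _ _ _ CG Qu U1) -(S3_G_act _ _ _ CG' Qu U1) act_orthogonal_sym1//.
  have -> : act Q X = \sum_i sym_coord i i (act Q X) *: sym_base i i.
    rewrite [LHS]sym_sumE; apply: eq_bigr => i _; rewrite (bigD1 i)//= big1 ?addr0// => j ji.
    move/is_diag_mxP : QD => /(_ i j); rewrite /sym_coord /= => ->; rewrite ?scale0r//.
    by rewrite eq_sym.
  by rewrite !S3_diag_expand.
have tri X Y Z : C sym1 X Y Z = C' sym1 X Y Z.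
  by rewrite (S3_polarization X Y Z C3 U1) (S3_polarization X Y Z C3' U1) !cube.
apply/funext => S; have [US|US] := pselect (U S); last first.
  by move: C3 C3' => [C0 _ _ _ _] [C0' _ _ _ _]; rewrite C0// C0'.
have [k ku SE] := SymPos_orbit US.
apply/funext => X; apply/funext => Y; apply/funext => Z.
rewrite SE -(actK X ku) -(actK Y ku) -(actK Z ku).
by rewrite (S3_G_act _ _ _ CG ku U1) (S3_G_act _ _ _ CG' ku U1).
Qed.

Lemma diag_coef_cubic u v w i j k : diag_coef (cubic u v w) i j k =
  u + v * ((j == k)%:R + (i == k)%:R + (i == j)%:R) + w * ((i == j) && (j == k))%:R.
Proof.
have trd (a b : 'I_n) : \tr (delta_mx a b : 'M[R]_n) = (a == b)%:R.
  rewrite /mxtrace (bigD1 a)//= mxE eqxx big1 ?addr0// => c ca.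
  by rewrite mxE (negbTE ca).
have t1 (a : 'I_n) : tr1 sym1 (sym_base a a) = 1 :> R.
  by rewrite /tr1 sym_base_diag invmx1 mul1mx trd eqxx.
have t2 (a b : 'I_n) : tr2 sym1 (sym_base a a) (sym_base b b) = (a == b)%:R :> R.
  rewrite /tr2 !sym_base_diag invmx1 !mul1mx mul_delta_mx_cond.
  by case: eqVneq => [->|ab]; rewrite ?mulr1n ?trd ?eqxx// mulr0n linear0.
have t3 : tr3 sym1 (sym_base i i) (sym_base j j) (sym_base k k) =
    ((i == j) && (j == k))%:R :> R.
  rewrite /tr3 !sym_base_diag invmx1 !mul1mx mul_delta_mx_cond.
  case: eqVneq => [->|ab]; last by rewrite mulr0n mul0mx linear0.
  rewrite mulr1n mul_delta_mx_cond; case: eqVneq => [->|jk]; rewrite ?mulr1n ?trd ?eqxx//.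
  by rewrite mulr0n linear0.
rewrite /diag_coef cubicE /cubic_fun; last exact: SymPos_sym1.
by rewrite !t1 !t2 t3; ring.
Qed.

Lemma S3_G_cubic C : S3_G C -> exists u v w : R,
  [/\ (n < 3)%N -> u = 0, (n < 2)%N -> v = 0 & C = cubic u v w].
Proof.
move=> CG; have [C3 _] := CG; have U1 := @SymPos_sym1 R n.
have [|||u [v [w [u0 v0 uvw]]]] := @perm_invariant_decomp R n (diag_coef C).
- by move=> *; exact: S3_sym12.
- by move=> *; exact: S3_sym23.
- by move=> *; exact: diag_coef_perm.
exists u, v, w; split=> //; apply: S3_G_eq => //; first exact: cubic_S3_G.
move=> x; apply: eq_bigr => i _; apply: eq_bigr => j _; apply: eq_bigr => k _.
by rewrite diag_coef_cubic uvw.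
Qed.

Definition cubic_symbol C : mpoly.mpoly n R := cubic_poly (diag_coef C).

(** Injectivity: equal polynomials have equal values, so the two cubic forms agree on diagonal
    matrices, which is enough for [S3_G_eq]. Surjectivity: the coefficient family of a symmetric
    cubic decomposes as the diagonal coefficients of some [cubic u v w]. *)
Lemma cubic_symbol_iso : linear_isomorphism (@S3_G R n) (@SP3 R n) cubic_symbol.
Proof.
split.
  move=> a C C' _ _; rewrite /cubic_symbol -cubic_poly_linear.
  by congr cubic_poly.
split=> [C CG|C C'|p /SP3_cubic_poly[c [c12 c23 cs ->]]].
- by apply: cubic_poly_SP3 => s i j k; exact: diag_coef_perm.
- rewrite !inE => CG CG' CC'; apply: S3_G_eq => // x.
  by rewrite -!meval_cubic_poly -/(cubic_symbol C) CC'.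
- have [u [v [w [_ _ uvw]]]] := perm_invariant_decomp c12 c23 cs.
  exists (cubic u v w); first exact: cubic_S3_G.
  rewrite /cubic_symbol; congr cubic_poly.
  by apply/funext => i; apply/funext => j; apply/funext => k; rewrite diag_coef_cubic uvw.
Qed.

Lemma cubic_symbol_tr3 (a : R) : cubic_symbol (cubic 0 0 a) =
  a *: \sum_(i < n) mpoly.mpolyX R (mpoly.mnm1 i) ^+ 3.
Proof.
rewrite /cubic_symbol /cubic_poly scaler_sumr.
rewrite (bigID (fun t : 'I_n * 'I_n * 'I_n => (t.1.1 == t.1.2) && (t.1.2 == t.2))) /=.
rewrite [X in _ + X]big1 ?addr0 => [|t /negbTE tE]; last first.
  by rewrite diag_coef_cubic tE mulr0 !mul0r !addr0 scale0r.
rewrite (reindex (fun i : 'I_n => (i, i, i))) /=; last first.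
  exists (fun t => t.2) => [//|[[i j] k]]; rewrite inE /= => /andP[/eqP -> /eqP ->] //.
apply: eq_big => [i|i _]; first by rewrite !eqxx.
rewrite diag_coef_cubic !eqxx mulr1 !mul0r !add0r /triple_mon !mpoly.mpolyXD.
by rewrite !exprS expr0 mulr1 mulrA.
Qed.

Lemma cubicD u v w u' v' w' :
  @cubic R n u v w + cubic u' v' w' = cubic (u + u') (v + v') (w + w').
Proof.
apply/funext => S; have [US|US] := pselect (U S); last first.
  by rewrite -[LHS]/(_ S + _ S) !cubic_out// addr0.
rewrite -[LHS]/(_ S + _ S) !cubicE//; apply/funext => X; apply/funext => Y; apply/funext => Z.
by rewrite -[LHS]/(_ X Y Z + _ X Y Z) /cubic_fun; ring.
Qed.

Lemma cubicZ a u v w : a *: @cubic R n u v w = cubic (a * u) (a * v) (a * w).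
Proof.
apply/funext => S; have [US|US] := pselect (U S); last first.
  by rewrite -[LHS]/(a *: _ S) !cubic_out// scaler0.
rewrite -[LHS]/(a *: _ S) !cubicE//; apply/funext => X; apply/funext => Y; apply/funext => Z.
by rewrite -[LHS]/(a * _ X Y Z) /cubic_fun; ring.
Qed.

(** Read off from the diagonal coefficients at the index triples [(0,0,0)], [(1,1,0)] and [(2,1,0)],
    as far as [n] provides these indices. *)
Lemma cubic_eq0 u v w : @cubic R n u v w = 0 ->
  [/\ (0 < n)%N -> u + v * 3 + w = 0, (1 < n)%N -> u + v = 0 & (2 < n)%N -> u = 0].
Proof.
move=> c0; have E (i j k : 'I_n) : u + v * ((j == k)%:R + (i == k)%:R + (i == j)%:R) +
    w * ((i == j) && (j == k))%:R = 0 by rewrite -diag_coef_cubic c0.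
split=> [n1|n2|n3].
- by have := E (Ordinal n1) (Ordinal n1) (Ordinal n1); rewrite !eqxx mulr1 -natrD -natrD.
- have := E (Ordinal n2) (Ordinal n2) (Ordinal (ltnW n2)).
  by rewrite eqxx /= !(mulr0, mulr1, addr0, add0r).
- have := E (Ordinal n3) (Ordinal (ltnW n3)) (Ordinal (ltnW (ltnW n3))).
  by rewrite /= !(mulr0, addr0).
Qed.

Lemma S3_G_dimension : (0 < n)%N ->
  has_dimension (@S3_G R n) (if (3 <= n)%N then 3 else if n == 2 then 2 else 1)%N.
Proof.
move=> n0; set d := (X in has_dimension _ X).
(* Ordered with [tr3] at index 0 and the product of traces at index 2: truncation to the first [d]
   members drops exactly the forms whose coefficients [S3_G_cubic] normalizes to 0. *)
pose b (i : nat) := @cubic R n (i == 2%N)%:R (i == 1%N)%:R (i == 0%N)%:R.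
have sumb (m : nat) (c : 'I_m -> R) : \sum_(i < m) c i *: b i =
    cubic (\sum_(i < m) c i * (i == 2 :> nat)%:R) (\sum_(i < m) c i * (i == 1 :> nat)%:R)
          (\sum_(i < m) c i * (i == 0 :> nat)%:R).
  elim: m c => [|m IH] c.
    rewrite !big_ord0 -[in RHS](mul0r (0 : R)) -cubicZ scale0r //.
  by rewrite !big_ord_recr/= IH cubicZ cubicD.
exists (fun i => b i); split.
  move=> c; rewrite sumb => /cubic_eq0[/(_ n0) + + +].
  rewrite /d in c *; move: c; case: ifPn => n3; last case: ifPn => n2.
  - move=> c; rewrite !big_ord_recr !big_ord0 /= !(mulr0, mulr1, add0r, addr0).
    move=> e1 /(_ (ltnW n3)) e2 /(_ isT) e3; move: e1 e2; rewrite e3 !add0r => e1 e2.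
    move: e1; rewrite e2 mul0r add0r => e1 [[|[|[|//]]] i3].
    + by rewrite -[RHS]e1; congr c; apply: val_inj.
    + by rewrite -[RHS]e2; congr c; apply: val_inj.
    + by rewrite -[RHS]e3; congr c; apply: val_inj.
  - move=> c; rewrite !big_ord_recr !big_ord0 /= !(mulr0, mulr1, add0r, addr0).
    rewrite (eqP n2) => e1 /(_ isT) e2 _; move: e1; rewrite e2 mul0r add0r => e1.
    move=> [[|[|//]] i2].
    + by rewrite -[RHS]e1; congr c; apply: val_inj.
    + by rewrite -[RHS]e2; congr c; apply: val_inj.
  - move=> c; rewrite !big_ord_recr !big_ord0 /= !(mulr0, mulr1, mul0r, add0r, addr0).
    move=> e1 _ _ [[|//] i1].
    by rewrite -[RHS]e1; congr c; apply: val_inj.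
apply/seteqP; split=> [C CG|C [c ->]]; last by rewrite sumb; exact: cubic_S3_G.
have [u [v [w [u0 v0 ->]]]] := S3_G_cubic CG.
exists (fun i : 'I_d => if val i is 0%N then w else if val i is 1%N then v else u).
rewrite sumb /d; case: ifPn => n3; last case: ifPn => n2.
- by rewrite !big_ord_recr !big_ord0 /= !(mulr0, mulr1, add0r, addr0).
- rewrite !big_ord_recr !big_ord0 /= !(mulr0, mulr1, add0r, addr0).
  by rewrite u0// ltnNge.
- rewrite !big_ord_recr !big_ord0 /= !(mulr0, mulr1, add0r, addr0).
  have n1 : n = 1%N by case: (n) n0 n2 n3 => [|[|[|]]].
  by rewrite u0 ?v0 ?n1.
Qed.

End Classification.

(** * Gaussian integrals *)

Section AffineSubstitution.
Context {R : realType}.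
Local Notation mu := (@lebesgue_measure R).

Lemma affine_preimage_itv (u b x y : R) : 0 < u ->
  (fun t => u * t + b) @^-1` `]x, y] = `](x - b) / u, (y - b) / u]%classic.
Proof.
move=> u0; apply/seteqP; split=> t /=; rewrite !in_itv/= ltr_pdivrMr// ler_pdivlMr//;
by rewrite ltrBlDr lerBrDr ![t * u]mulrC.
Qed.

Lemma measurable_affine (u b : R) :
  measurable_fun [set: measurableTypeR R]
    (fun t : measurableTypeR R => u * t + b : measurableTypeR R).
Proof. by apply: measurable_funD => //; exact: measurable_funM. Qed.

(** The pushforward of Lebesgue measure by [t |-> u t + b], scaled by [u], gives half-open intervals
    their length, so it is Lebesgue measure by uniqueness. *)
Lemma ge0_integral_affine (u b : R) (f : R -> \bar R) : 0 < u ->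
  measurable_fun [set: R] f -> (forall x, 0 <= f x)%E ->
  (\int[mu]_x f x = u%:E * \int[mu]_x f (u * x + b)%R)%E.
Proof.
move=> u0 mf f0; have mphi := measurable_affine u b.
pose nu := measure_function_pushforward__canonical__measure_function_Measure mu mphi.
pose k : {nonneg R} := NngNum (ltW u0).
transitivity (\int[mscale k nu]_x f x)%E.
  apply: eq_measure_integral => A mA _.
  apply: (@lebesgue_measure_unique R (mscale k nu)) => //= _ [[x y] _ <-].
  rewrite /mscale /= /pushforward affine_preimage_itv// !lebesgue_measure_itv/= !lte_fin.
  rewrite ltr_pM2r ?invr_gt0// ltrD2r; case: ifP => _; last by rewrite mule0.
  rewrite -EFinB -EFinM; congr (_%:E).
  by field; rewrite gt_eqF.
rewrite ge0_integral_mscale//; congr (_ * _)%E.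
exact: (ge0_integral_pushforward mphi).
Qed.

End AffineSubstitution.

Section LinearSubstitution.
Context {R : realType}.
Local Notation Rn n := (n.-tuple (measurableTypeR R)).
Local Notation mu := (@lebesgue_measure R).

Lemma measurable_vec n (i : 'I_n) : measurable_fun [set: Rn n] (fun x => vec x i 0 : R).
Proof.
by under eq_fun do rewrite mxE; exact: (@measurable_tnth _ (measurableTypeR R)).
Qed.

Lemma measurable_mulmx_vec m n (M : 'M[R]_(m, n)) i :
  measurable_fun [set: Rn n] (fun x => (M *m vec x) i 0 : R).
Proof.
under eq_fun do rewrite mxE.
by apply: measurable_sum => j; apply: measurable_funM => //; exact: measurable_vec.
Qed.

Definition mulv n (M : 'M[R]_n) (x : Rn n) : Rn n := [tuple (M *m vec x) i 0 | i < n].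

Lemma vec_mulv n (M : 'M[R]_n) (x : Rn n) : vec (mulv M x) = M *m vec x.
Proof. by apply/colP => i; rewrite mxE tnth_mktuple. Qed.

Lemma measurable_mulv n (M : 'M[R]_n) : measurable_fun [set: Rn n] (mulv M).
Proof.
apply/measurable_fun_tnthP => i.
rewrite (_ : _ \o _ = fun x => (M *m vec x) i 0); first exact: measurable_mulmx_vec.
by apply/funext => x /=; rewrite tnth_mktuple.
Qed.

Lemma vec_cons_pair n (p : measurableTypeR R * Rn n) :
  vec (cons_pair p) = col_mx p.1%:M (vec p.2) :> 'cV_(1 + n).
Proof.
apply/colP => i; case: (split_ordP i) => j ->.
  by rewrite col_mxEu !mxE !ord1 eqxx mulr1n (_ : lshift n 0 = 0)//; exact: val_inj.
by rewrite col_mxEd !mxE rshift1 tnthS; congr tnth; apply: val_inj.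
Qed.

Lemma vec_inj n : injective (@vec R n).
Proof.
move=> x y /colP xy; apply: eq_from_tnth => i.
by have := xy i; rewrite !mxE.
Qed.

(** The transpose being upper triangular, the tail of the image depends on the tail alone, and its
    head is affine in the head once the tail is fixed: the shape suited to an iterated integral. *)
Lemma mulv_cons_pair n (a : R) (c : 'cV[R]_n) (A : 'M[R]_n) (p : measurableTypeR R * Rn n) :
  mulv (block_mx a%:M 0 c A)^T (cons_pair p : Rn (1 + n)) =
  cons_pair (a * p.1 + (c^T *m vec p.2) 0 0, mulv A^T p.2).
Proof.
apply: vec_inj; rewrite vec_mulv !vec_cons_pair /= vec_mulv tr_block_mx mul_block_col.
rewrite trmx0 mul0mx add0r tr_scalar_mx -scalar_mxM; congr col_mx.
by rewrite [RHS]raddfD/= -mx11_scalar.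
Qed.

Local Open Scope ereal_scope.

Lemma ge0_integral_lebesgue_RnS n (F : Rn n.+1 -> \bar R) :
  measurable_fun setT F -> (forall z, 0 <= F z) ->
  \int[lebesgue_Rn n.+1]_z F z =
  \int[lebesgue_Rn n]_y \int[mu]_x F (cons_pair (x, y)).
Proof.
move=> mF F0.
transitivity (\int[pushforward (mu \x lebesgue_Rn n) (@cons_pair R n)]_z F z).
  by [].
rewrite (ge0_integral_pushforward (@measurable_cons_pair R n))//= preimage_setT.
rewrite (fubini_tonelli2 (F \o @cons_pair R n))//.
  by apply: measurableT_comp => //; exact: measurable_cons_pair.
by move=> p; exact: F0.
Qed.

(** Induction on the blocks: the tail is substituted by the induction hypothesis for [A], the head
    by an affine map of slope [a]; the factors multiply to [a * \det A = \det L]. *)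
Lemma ge0_integral_mulv_trig n (L : 'M[R]_n) (F : Rn n -> \bar R) :
  is_trig_mx L -> (forall i, 0 < L i i)%R ->
  measurable_fun setT F -> (forall z, 0 <= F z) ->
  \int[lebesgue_Rn n]_z F z =
  (\det L)%:E * \int[lebesgue_Rn n]_z F (mulv L^T z).
Proof.
move=> Lt; move: F; elim/trigsqmx_ind: n L / Lt => [|n x c A At IH] F Ld mF F0.
  rewrite det_mx00 mul1e; apply: eq_integral => z _; congr F.
  by rewrite [LHS]tuple0 [RHS]tuple0.
have [a xa] : exists a : R, x = a%:M by exists (x 0%R 0%R); exact: mx11_scalar.
rewrite {}xa in Ld *.
have a0 : (0 < a)%R.
  by have := Ld (lshift n 0%R); rewrite block_mxEul mxE eqxx mulr1n.
have Ad i : (0 < A i i)%R by have := Ld (rshift 1 i); rewrite block_mxEdr.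
have mFc : measurable_fun setT (F \o @cons_pair R n).
  by apply: measurableT_comp => //; exact: measurable_cons_pair.
have mFL : measurable_fun setT (fun z => F (mulv (block_mx a%:M 0 c A)^T z)).
  by apply: measurableT_comp => //; exact: measurable_mulv.
rewrite (@ge0_integral_lebesgue_RnS n F)// (@ge0_integral_lebesgue_RnS n (fun z => F (mulv _ z)))//.
rewrite (IH (fun y => \int[mu]_x F (cons_pair (x, y))))//; last 2 first.
- by apply: (measurable_fun_fubini_tonelli_G (F \o @cons_pair R n)) => // p; exact: F0.
- by move=> y; apply: integral_ge0.
rewrite det_lblock det_scalar1 mulrC EFinM -muleA; congr (_ * _).
rewrite -ge0_integralZl//; last 3 first.
- apply: (measurable_fun_fubini_tonelli_G
    ((fun z => F (mulv (block_mx a%:M 0 c A)^T z)) \o @cons_pair R n)) => [|p]; last exact: F0.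
  by apply: measurableT_comp => //; exact: measurable_cons_pair.
- by move=> y _; exact: integral_ge0.
- by rewrite lee_fin ltW.
apply: eq_integral => y _.
rewrite (ge0_integral_affine ((c^T *m vec y) 0 0)%R a0)//; last first.
  by apply: (measurableT_comp mFc); exact: pair2_measurable.
congr (_ * _); apply: eq_integral => t _.
by rewrite -[in LHS](mulv_cons_pair a c A (t, y)).
Qed.

End LinearSubstitution.

(** * Moments of the standard Gaussian on the line *)

Section GaussianMoments.
Context {R : realType}.
Local Notation mu := (@lebesgue_measure R).

Definition gauss (x : R) : R := (Num.sqrt (2 * pi))^-1 * expR (- x ^+ 2 / 2).

Lemma gauss_normal_pdf : gauss = normal_pdf 0 1.
Proof.
rewrite normal_pdfE ?oner_eq0//; apply/funext => x; rewrite /gauss /normal_fun.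
by rewrite /normal_peak expr1n subr0 mul1r (mulr_natl pi 2).
Qed.

Lemma gauss_ge0 x : 0 <= gauss x.
Proof. by rewrite mulr_ge0 ?expR_ge0// invr_ge0 sqrtr_ge0. Qed.

Lemma expr_le_expR k (y : R) : 0 <= y -> y ^+ k <= k`!%:R * expR y.
Proof.
move=> y0; case: k => [|k]; first by rewrite expr0 fact0 mul1r (le_trans _ (expR_ge1Dx y))// lerDl.
rewrite mulrC -ler_pdivrMr ?ltr0n ?fact_gt0//.
by apply: le_trans (expR_ge1Dxn k y0); rewrite lerDr.
Qed.

(** Half of the exponent absorbs the power: with [y = x^2/4], one has [|x^k| <= 1 + 4^k y^k] and
    [y^k <= k! e^y], while the other factor [e^(-y)] remains. *)
Lemma gauss_moment_bound k : exists2 C : R, 0 <= C &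
  forall x, `|x ^+ k * gauss x| <= C * expR (- (x ^+ 2 / 4)).
Proof.
pose c : R := (Num.sqrt (2 * pi))^-1; have c0 : 0 <= c by rewrite invr_ge0 sqrtr_ge0.
exists ((1 + 4 ^+ k * k`!%:R) * c) => [|x]; first by rewrite mulr_ge0// addr_ge0// mulr_ge0.
have y0 : 0 <= x ^+ 2 / 4 by rewrite divr_ge0 ?sqr_ge0.
have yE : - x ^+ 2 / 2 = - (x ^+ 2 / 4) - x ^+ 2 / 4 by field.
rewrite normrM (ger0_norm (gauss_ge0 x)) /gauss -/c yE expRD.
set E := expR (- _).
have -> : `|x ^+ k| * (c * (E * E)) = (`|x ^+ k| * E) * (c * E) by ring.
rewrite -[leRHS]mulrA ler_wpM2r ?mulr_ge0 ?expR_ge0//.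
rewrite /E expRN ler_pdivrMr ?expR_gt0// mulrDl mul1r.
(* This is [r <= 1 + r^2] for [r = |x^k|]. *)
have xk : `|x ^+ k| <= 1 + 4 ^+ k * (x ^+ 2 / 4) ^+ k.
  rewrite -exprMn [4 * _]mulrC divfK// -exprM mulnC exprM.
  rewrite -(real_normK (num_real (x ^+ k))).
  have [h|h] := leP `|x ^+ k| 1; first by rewrite (le_trans h)// lerDl sqr_ge0.
  by rewrite ler_wpDl// expr2 ler_peMl// ltW.
apply: le_trans xk _; rewrite lerD//; first by rewrite (le_trans _ (expR_ge1Dx _))// lerDl.
by rewrite -[leRHS]mulrA ler_wpM2l// expr_le_expR.
Qed.

Lemma continuous_gauss : continuous gauss.
Proof. by rewrite gauss_normal_pdf; apply: continuous_normal_pdf; rewrite oner_eq0. Qed.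

Lemma continuous_expr k : continuous (fun x : R => x ^+ k).
Proof. exact: exprn_continuous. Qed.

Lemma continuous_gauss_moment k : continuous (fun x : R => x ^+ k * gauss x).
Proof. by move=> x; apply: cvgM; [exact: continuous_expr|exact: continuous_gauss]. Qed.

(** Up to its peak constant, the function is the normal density of standard deviation [sqrt 2]. *)
Lemma integrable_expR_sqr :
  mu.-integrable [set: R] (fun x => (expR (- (x ^+ 2 / 4)))%:E).
Proof.
have s2 : Num.sqrt 2 != 0 :> R by rewrite gt_eqF// sqrtr_gt0.
have -> : (fun x : R => (expR (- (x ^+ 2 / 4)))%:E) =
    (fun x => (normal_peak (Num.sqrt 2))^-1%:E * (normal_pdf 0 (Num.sqrt 2) x)%:E)%E.
  apply/funext => x; rewrite normal_pdfE// -EFinM mulrA mulVf ?mul1r; last first.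
    by rewrite gt_eqF// normal_peak_gt0.
  congr (expR _)%:E; rewrite subr0 sqr_sqrtr// mulNr; congr (- (_ / _)).
  by rewrite -mulr_natl; ring.
exact/integrableZl/integrable_normal_pdf.
Qed.

Lemma integrable_gauss_moment k :
  mu.-integrable [set: R] (fun x => (x ^+ k * gauss x)%:E).
Proof.
have [C C0 HC] := gauss_moment_bound k.
apply: (le_integrable measurableT _ _ (integrableZl measurableT C integrable_expR_sqr)).
  by apply/measurable_EFinP; exact: continuous_measurable_fun (@continuous_gauss_moment k).
by move=> x _ /=; rewrite lee_fin (le_trans (HC x))// ler_norm.
Qed.

(** Dominated convergence; it carries the fundamental theorem of calculus from compact intervals to
    the line. *)
Lemma integral_truncation_cvg (f : R -> R) : mu.-integrable [set: R] (EFin \o f) ->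
  (fun n : nat => \int[mu]_(x in `[(- n.+1%:R)%R, n.+1%:R]) (f x)%:E)%E @ \oo -->
  (\int[mu]_x (f x)%:E)%E.
Proof.
move=> fi; have mf := measurable_int _ fi.
under eq_fun do rewrite integral_mkcond.
pose A n : set R := `[(- n.+1%:R)%R, n.+1%:R]%classic.
have mA n : measurable (A n) by exact: measurable_itv.
have H1 n : measurable_fun [set: R] ((EFin \o f) \_ (A n)).
  by apply/(measurable_restrictT _ (mA n)); exact: measurable_funTS.
have H2 : {ae mu, forall x, [set: R] x ->
    (fun n => ((EFin \o f) \_ (A n)) x) @ \oo --> (EFin \o f) x}.
  apply: aeW => x _; apply: cvg_near_cst; near=> n.
  rewrite patchE mem_set// /A /= in_itv/= -ler_norml.
  apply: (@le_trans _ _ n%:R); last by rewrite ler_nat.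
  by near: n; exact: nbhs_infty_ger.
have H4 : {ae mu, forall x n, [set: R] x ->
    (`|((EFin \o f) \_ (A n)) x| <= `|(f x)%:E|)%E}.
  by apply: aeW => x n _; rewrite patchE; case: ifP => //; rewrite abse0.
by have [] :=
  @dominated_convergence _ _ _ mu setT measurableT _ _ _ H1 mf H2 (integrable_abse fi) H4.
Unshelve. all: by end_near. Qed.

Definition gauss_moment k : R := \int[mu]_x (x ^+ k * gauss x).

Lemma gauss_moment0 : gauss_moment 0 = 1.
Proof.
rewrite /gauss_moment /Rintegral; under eq_integral do rewrite expr0 mul1r gauss_normal_pdf.
by rewrite integral_normal_pdf.
Qed.

Lemma derive_gauss_moment k (x : R) : is_derive x 1 (fun x : R => x ^+ k * gauss x)
  (k%:R * (x ^+ k.-1 * gauss x) - x ^+ k.+1 * gauss x).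
Proof.
have d1 : is_derive x 1 (fun x : R => x ^+ k) (k%:R * x ^+ k.-1).
  apply: DeriveDef; first exact: exprn_derivable.
  by rewrite exp_derive /GRing.scale /= mulr1.
have d2 : is_derive x 1 gauss (- (x * gauss x)).
  have dx : is_derive x 1 (fun x : R => x ^+ 2) (2 * x).
    apply: DeriveDef; first exact: exprn_derivable.
    by rewrite exp_derive /GRing.scale /= mulr1.
  have dh : is_derive x 1 (fun x : R => - x ^+ 2 / 2) (- x).
    have -> : (fun x : R => - x ^+ 2 / 2) = - 2^-1 *: (fun x : R => x ^+ 2).
      by apply/funext => y; rewrite fctE /GRing.scale /=; ring.
    by apply: is_derive_eq (is_deriveZ _ dx) _; rewrite /GRing.scale /=; field.
  have de := is_derive1_comp (is_derive_expR _) dh.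
  have dg : is_derive x 1 gauss _ := is_deriveZ (Num.sqrt (2 * pi))^-1 de.
  by apply: is_derive_eq dg _; rewrite /gauss /GRing.scale /=; ring.
apply: is_derive_eq (is_deriveM d1 d2) _.
rewrite /GRing.scale /= exprS; ring.
Qed.

(** The bound for exponent [k + 1], divided by [n + 1], gives [C / (n + 1)]. *)
Lemma gauss_moment_cvg0 k : (fun n : nat => (n.+1%:R ^+ k * gauss n.+1%:R : R)) @ \oo --> (0 : R).
Proof.
have [C C0 HC] := gauss_moment_bound k.+1.
have hC : C * harmonic n @[n --> \oo] --> (0 : R).
  by rewrite -(mulr0 C); apply: cvgM; [exact: cvg_cst|exact: cvg_harmonic].
apply: (squeeze_cvgr _ (cvg_cst (0 : R)) hC); near=> n.
rewrite mulr_ge0 ?gauss_ge0//= /harmonic /= ler_pdivlMr//.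
apply: le_trans (ler_norm _) _.
rewrite mulrAC -exprSr; apply: le_trans (HC _) _.
by rewrite ler_piMr// expR_le1 oppr_le0 divr_ge0.
Unshelve. all: by end_near. Qed.

(** Integration by parts: the derivative [f] of [x^k gauss] has integral 0 because the boundary
    terms vanish at infinity. For [k = 0] the truncated [k.-1] is multiplied by 0. *)
Lemma gauss_momentS k : gauss_moment k.+1 = k%:R * gauss_moment k.-1.
Proof.
pose F (x : R) := x ^+ k * gauss x.
pose f (x : R) := k%:R * (x ^+ k.-1 * gauss x) - x ^+ k.+1 * gauss x.
have i1 := integrable_gauss_moment k.-1; have i2 := integrable_gauss_moment k.+1.
have ki1 : mu.-integrable [set: R] (fun x => (k%:R * (x ^+ k.-1 * gauss x))%:E).
  exact: (integrableZl measurableT k%:R i1).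
have fi : mu.-integrable [set: R] (EFin \o f) by exact: (integrableB measurableT ki1 i2).
have If n : (\int[mu]_(x in `[(- n.+1%:R)%R, n.+1%:R]) (f x)%:E = (F n.+1%:R - F (- n.+1%:R))%:E)%E.
  have FD (x : R) : is_derive x 1 F (f x) by exact: derive_gauss_moment.
  have cF : continuous F by exact: continuous_gauss_moment.
  rewrite (@continuous_FTC2 _ f F)//.
  - by rewrite gtrN.
  - apply: continuous_subspaceT => x; apply: cvgB; last exact: continuous_gauss_moment.
    by apply: cvgM; [exact: cvg_cst|exact: continuous_gauss_moment].
  - split=> [x _||]; first by case: (FD x).
      exact/cvg_at_right_filter/cF.
    exact/cvg_at_left_filter/cF.
  - by move=> x _; rewrite derive1E; case: (FD x).
have F0 : (fun n : nat => (F n.+1%:R - F (- n.+1%:R))%:E) @ \oo --> 0%E.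
  apply: cvg_EFin; first by near=> n.
  (* By parity, the limit at plus infinity settles both boundary terms. *)
  have FN (y : R) : F y - F (- y) = (1 - (-1) ^+ k) * (y ^+ k * gauss y).
    rewrite /F (exprNn y) /gauss sqrrN; move: ((-1) ^+ k) (y ^+ k) (expR _) => a b e.
    by ring.
  apply: (@cvg_trans _ ((fun n : nat =>
      (1 - (-1) ^+ k) * (n.+1%:R ^+ k * gauss n.+1%:R) : R) @ \oo)).
    by apply: near_eq_cvg; near=> n; rewrite /= FN.
  have h : (fun n : nat => (1 - (-1) ^+ k) * (n.+1%:R ^+ k * gauss n.+1%:R) : R) @ \oo -->
      ((1 - (-1) ^+ k) * 0 : R).
    by apply: cvgM; [exact: cvg_cst|exact: gauss_moment_cvg0].
  by rewrite mulr0 in h.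
have := integral_truncation_cvg fi; under eq_fun do rewrite If.
move=> fI; have I0 := cvg_unique (@ereal_hausdorff R) F0 fI.
have : Rintegral mu setT f = 0 by rewrite /Rintegral -I0.
rewrite /f RintegralB// RintegralZl//.
by move=> /eqP; rewrite subr_eq0 eq_sym => /eqP.
Unshelve. all: by end_near. Qed.

End GaussianMoments.

Section ProductIntegrals.
Context {R : realType}.
Local Notation Rn n := (n.-tuple (measurableTypeR R)).
Local Notation mu := (@lebesgue_measure R).
Local Open Scope ereal_scope.

Lemma integral_lebesgue_RnS n (F : Rn n.+1 -> \bar R) :
  measurable_fun setT F ->
  (mu \x lebesgue_Rn n).-integrable setT (F \o @cons_pair R n) ->
  (lebesgue_Rn n.+1).-integrable setT F /\
  \int[lebesgue_Rn n.+1]_z F z =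
  \int[lebesgue_Rn n]_y \int[mu]_x F (cons_pair (x, y)).
Proof.
move=> mF iF; have mc := @measurable_cons_pair R n; split.
  exact: (integrable_pushforward mc mF).
rewrite (integral21_prod_meas1 iF).
exact: (integral_pushforward mc mF).
Qed.

Lemma measurable_prod_tnth n (f : 'I_n -> R -> R) :
  (forall i, measurable_fun setT (f i)) ->
  measurable_fun [set: Rn n] (fun x => \prod_i f i (tnth x i))%R.
Proof.
move=> mf; apply: measurable_prod => i _.
by apply: (measurableT_comp (mf i)); exact: (@measurable_tnth _ (measurableTypeR R)).
Qed.

(** Integrability is carried through the induction because Fubini for signed functions requires it;
    it comes from Tonelli applied to the absolute values, whose integral factors. *)
Lemma integral_prod_tnth n (f : 'I_n -> R -> R) :
  (forall i, mu.-integrable setT (EFin \o f i)) ->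
  (lebesgue_Rn n).-integrable setT (fun x => (\prod_i f i (tnth x i))%:E) /\
  \int[lebesgue_Rn n]_x (\prod_i f i (tnth x i))%:E = (\prod_i \int[mu]_x f i x)%:E.
Proof.
elim: n f => [|n IH] f fi.
  have E : (fun x : Rn 0 => (\prod_(i < 0) f i (tnth x i))%:E) = cst 1.
    by apply/funext => x; rewrite big_ord0.
  rewrite E big_ord0; split; last by rewrite integral_dirac// diracE in_setT mul1e.
  apply/integrableP; split; first exact: measurable_cst.
  by rewrite integral_dirac// diracE in_setT mul1e /= normr1 ltry.
have mf i : measurable_fun setT (f i) by apply/measurable_EFinP; exact: measurable_int (fi i).
have [IHi IHI] := IH (fun i => f (lift ord0 i)) (fun i => fi _).
pose g (x : Rn n) := (\prod_i f (lift ord0 i) (tnth x i))%R.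
have mg : measurable_fun [set: Rn n] g.
  exact: (@measurable_prod_tnth n (fun i => f (lift ord0 i)) (fun i => mf _)).
have FE p : (\prod_i f i (tnth (cons_pair p) i) = f ord0 p.1 * g p.2)%R.
  rewrite big_ord_recl; congr (_ * _)%R; apply: eq_bigr => i _.
  by rewrite tnthS; congr (f _ (tnth _ _)); exact: val_inj.
pose F (z : Rn n.+1) := (\prod_i f i (tnth z i))%:E.
have mF : measurable_fun setT F by apply/measurable_EFinP; exact: measurable_prod_tnth.
have iF : (mu \x lebesgue_Rn n).-integrable setT (F \o @cons_pair R n).
  apply/integrable21ltyP.
    by apply: measurableT_comp => //; exact: measurable_cons_pair.
  have -> : \int[lebesgue_Rn n]_y \int[mu]_x `|(F \o @cons_pair R n) (x, y)| =
      \int[mu]_x `|(f ord0 x)%:E| * \int[lebesgue_Rn n]_y `|(g y)%:E|.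
    rewrite -ge0_integralZl//; last 2 first.
    - by apply: measurableT_comp => //; exact/measurable_EFinP.
    - exact: integral_ge0.
    apply: eq_integral => y _; rewrite -ge0_integralZr//; last first.
      by apply: measurableT_comp => //; exact: measurable_int (fi ord0).
    by apply: eq_integral => x _; rewrite -abseM -EFinM -(FE (x, y)).
  have /integrableP[_ i0] := fi ord0; have /integrableP[_ i1] := IHi.
  by rewrite lte_mul_pinfty//; [exact: integral_ge0|rewrite ge0_fin_numE//; exact: integral_ge0].
have [H1 H2] := integral_lebesgue_RnS mF iF; split=> //; rewrite H2.
rewrite big_ord_recl EFinM -IHI.
have fin0 := integrable_fin_num measurableT (fi ord0).
have -> : (\int[mu]_x f ord0 x)%R%:E = \int[mu]_x (f ord0 x)%:E by rewrite fineK.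
rewrite -[in RHS](fineK fin0) -integralZl//; apply: eq_integral => y _.
rewrite (fineK fin0) -(integralZr measurableT (fi ord0) (g y)).
by apply: eq_integral => x _; rewrite -EFinM -(FE (x, y)).
Qed.

End ProductIntegrals.

(** * Gaussian mean as a linear functional on polynomials *)

Section GaussianPolynomials.
Context {R : realType} {n : nat}.
Local Notation Rn := (n.-tuple (measurableTypeR R)).
Local Notation mu := (@lebesgue_measure R).
Implicit Types (p q : mpoly.mpoly n R) (A B C : 'M[R]_n).

Definition std_gauss (y : Rn) : R := \prod_i gauss (tnth y i).

Definition peval p (y : Rn) : R := mpoly.meval (fun i => tnth y i) p.

Definition gauss_mean p : R := \int[lebesgue_Rn n]_y (peval p y * std_gauss y).

Lemma peval_monomial (m : mpoly.multinom n) y :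
  peval (mpoly.mpolyX R m) y * std_gauss y =
  \prod_i (tnth y i ^+ mpoly.fun_of_multinom m i * gauss (tnth y i)).
Proof. by rewrite /peval mpoly.mevalX big_split. Qed.

Lemma integrable_monomial (m : mpoly.multinom n) : (lebesgue_Rn n).-integrable setT
  (EFin \o (fun y => peval (mpoly.mpolyX R m) y * std_gauss y)).
Proof.
have [] := @integral_prod_tnth R n
  (fun i x => x ^+ mpoly.fun_of_multinom m i * gauss x) (fun i => integrable_gauss_moment _).
by move=> H _; under eq_fun do rewrite /= peval_monomial.
Qed.

Lemma integrable_peval p : (lebesgue_Rn n).-integrable setT
  (EFin \o (fun y => peval p y * std_gauss y)).
Proof.
elim/mpoly.mpolyind: p => [|c m p _ _ IH].
  under eq_fun do rewrite /= /peval mpoly.meval0 mul0r.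
  exact: integrable0.
have := integrableD measurableT (integrableZl measurableT c (integrable_monomial m)) IH.
apply: eq_integrable => // y _ /=.
by rewrite -EFinM -EFinD mulrA -mulrDl /peval mpoly.mevalD mpoly.mevalZ.
Qed.

Lemma gauss_meanP a p q : gauss_mean (a *: p + q) = a * gauss_mean p + gauss_mean q.
Proof.
rewrite /gauss_mean -RintegralZl ?integrable_peval// -RintegralD//; last 2 first.
- exact: (integrableZl measurableT a (integrable_peval p)).
- exact: integrable_peval.
congr fine; apply: eq_integral => y _.
by rewrite mulrA -mulrDl /peval mpoly.mevalD mpoly.mevalZ.
Qed.

Lemma gauss_mean0 : gauss_mean 0 = 0.
Proof. by have := gauss_meanP (-1) 0 0; rewrite scaler0 addr0 mulN1r addNr. Qed.

Lemma gauss_meanD p q : gauss_mean (p + q) = gauss_mean p + gauss_mean q.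
Proof. by have := gauss_meanP 1 p q; rewrite scale1r mul1r. Qed.

Lemma gauss_meanZ a p : gauss_mean (a *: p) = a * gauss_mean p.
Proof. by have := gauss_meanP a p 0; rewrite gauss_mean0 !addr0. Qed.

Lemma gauss_mean_sum (I : Type) (r : seq I) (P : pred I) (f : I -> mpoly.mpoly n R) :
  gauss_mean (\sum_(i <- r | P i) f i) = \sum_(i <- r | P i) gauss_mean (f i).
Proof. by apply: (big_morph gauss_mean gauss_meanD gauss_mean0). Qed.

Lemma gauss_mean_monomial (m : mpoly.multinom n) :
  gauss_mean (mpoly.mpolyX R m) = \prod_i gauss_moment (mpoly.fun_of_multinom m i).
Proof.
rewrite /gauss_mean /Rintegral; under eq_integral do rewrite peval_monomial.
have [_ ->] := @integral_prod_tnth R n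
  (fun i x => x ^+ mpoly.fun_of_multinom m i * gauss x) (fun i => integrable_gauss_moment _).
by [].
Qed.

Lemma gauss_mean1 : gauss_mean 1 = 1.
Proof.
rewrite -mpoly.mpolyX0 gauss_mean_monomial big1// => i _.
by rewrite mpoly.mnm0E gauss_moment0.
Qed.

Local Notation X i := (mpoly.mpolyX R (mpoly.mnm1 i)).
Local Notation D i := (mpoly.mderiv i).

(** By linearity it suffices to treat monomials, whose means factor over the coordinates; only
    coordinate [i] changes, by [gauss_momentS]. *)
Lemma gauss_mean_stein i p : gauss_mean (X i * p) = gauss_mean (D i p).
Proof.
elim/mpoly.mpolyind: p => [|c m p _ _ IH]; first by rewrite mulr0 raddf0.
rewrite mulrDr -scalerAr linearD linearZ /= !gauss_meanP IH; congr (_ * _ + _).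
rewrite -mpoly.mpolyXD mpoly.mderivX gauss_meanZ !gauss_mean_monomial.
rewrite (bigD1 i)//= [in RHS](bigD1 i)//= mulrA; congr (_ * _).
  by rewrite mpoly.mnmDE mpoly.mnmBE mpoly.mnm1E eqxx add1n subn1 gauss_momentS.
apply: eq_bigr => j ji.
by rewrite mpoly.mnmDE mpoly.mnmBE mpoly.mnm1E eq_sym (negbTE ji) subn0.
Qed.

End GaussianPolynomials.
Section GaussianScores.
Context {R : realType} {n : nat}.
Local Notation Rn := (n.-tuple (measurableTypeR R)).
Implicit Types (p q : mpoly.mpoly n R) (A B C : 'M[R]_n).
Local Notation X i := (mpoly.mpolyX R (mpoly.mnm1 i)).
Local Notation D i := (mpoly.mderiv i).

Lemma mderiv_sum (i : 'I_n) (I : Type) (r : seq I) (P : pred I) (f : I -> mpoly.mpoly n R) :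
  D i (\sum_(j <- r | P j) f j) = \sum_(j <- r | P j) D i (f j).
Proof. exact: raddf_sum. Qed.

Lemma mderiv_var (i j : 'I_n) : D i (X j) = ((i == j)%:R : R) *: 1.
Proof.
rewrite mpoly.mderivX mpoly.mnm1E eq_sym; case: eqVneq => [->|_]; last by rewrite !scale0r.
congr (_ *: _); rewrite -mpoly.mpolyX0; congr mpoly.mpolyX.
by apply/mpoly.mnmP => k; rewrite mpoly.mnmBE subnn mpoly.mnm0E.
Qed.

Lemma gauss_mean_varM (i j : 'I_n) p :
  gauss_mean (X i * (X j * p)) = (i == j)%:R * gauss_mean p + gauss_mean (D j (D i p)).
Proof.
rewrite gauss_mean_stein mpoly.mderivM gauss_meanD mderiv_var -scalerAl mul1r.
by rewrite gauss_meanZ gauss_mean_stein.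
Qed.

(* The derivative of the log-density in the direction [X], as a function of the
   standardised variable [y = L^T x], where [S^-1 = L L^T] and [A = L^T X L]. *)
Definition score_poly A : mpoly.mpoly n R :=
  2^-1 *: (\sum_i \sum_j A i j *: (X i * X j) - \tr A *: 1).

Lemma peval_score_poly A (y : Rn) :
  peval (score_poly A) y = ((vec y)^T *m A *m vec y) 0 0 / 2 - \tr A / 2.
Proof.
rewrite /peval mpoly.mevalZ mpoly.mevalB mpoly.mevalZ mpoly.meval1 mulr1 mulrBr.
congr (_ - _); last by rewrite mulrC.
rewrite mulrC mxE exchange_big raddf_sum /=; congr (_ / _).
apply: eq_bigr => j _; rewrite raddf_sum mxE mulr_suml; apply: eq_bigr => i _.
rewrite /= mpoly.mevalZ mpoly.mevalM !mpoly.mevalXU !mxE; ring.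
Qed.

(** Stein's identity used twice on [X i * X j * p] leaves a Kronecker term and a second derivative.
    The Kronecker terms sum to [\tr A] times the mean of [p], which the centring of the score
    cancels. *)
Lemma gauss_mean_scoreM A p : gauss_mean (score_poly A * p) =
  2^-1 * \sum_i \sum_j A i j * gauss_mean (D j (D i p)).
Proof.
rewrite /score_poly -scalerAl gauss_meanZ mulrBl gauss_meanD -scaleN1r gauss_meanZ mulN1r.
rewrite -scalerAl mul1r gauss_meanZ; congr (_ * _).
rewrite mulr_suml gauss_mean_sum.
under eq_bigr do rewrite mulr_suml gauss_mean_sum.
under eq_bigr do under eq_bigr do
  rewrite -scalerAl -mulrA gauss_meanZ gauss_mean_varM mulrDr.
under eq_bigr do rewrite big_split.
rewrite big_split /= -[RHS]add0r addrAC; congr (_ + _).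
apply/eqP; rewrite subr_eq0; apply/eqP.
rewrite /mxtrace mulr_suml; apply: eq_bigr => i _.
rewrite (bigD1 i)//= eqxx mul1r big1 ?addr0// => j ji.
by rewrite eq_sym (negbTE ji) mul0r mulr0.
Qed.

Lemma mderiv_score_poly A (i : 'I_n) : A^T = A -> D i (score_poly A) = \sum_k A i k *: X k.
Proof.
move=> AT; rewrite mpoly.mderivZ mpoly.mderivB mpoly.mderivZ.
rewrite -mpoly.mpolyC1 mpoly.mderivC scaler0 subr0 mderiv_sum.
under eq_bigr do rewrite mderiv_sum.
under eq_bigr do under eq_bigr do
  rewrite mpoly.mderivZ mpoly.mderivM !mderiv_var -scalerAl -scalerAr mul1r mulr1 scalerDr !scalerA.
under eq_bigr do rewrite big_split.
rewrite big_split /= [T in T + _](bigD1 i)//= [T in _ + T + _]big1 ?addr0; last first.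
  by move=> k ki; rewrite big1// => l _; rewrite eq_sym (negbTE ki) mulr0 scale0r.
rewrite [T in _ + T](_ : _ = \sum_k A i k *: X k).
  under eq_bigr do rewrite eqxx mulr1.
  by rewrite scalerDr -scalerDl -div1r -splitr scale1r.
apply: eq_bigr => k _; rewrite (bigD1 i)//= eqxx mulr1 big1 ?addr0 => [|l li].
  by rewrite -{1}AT mxE.
by rewrite eq_sym (negbTE li) mulr0 scale0r.
Qed.

Lemma mderiv2_score_poly A (i j : 'I_n) : A^T = A -> D j (D i (score_poly A)) = A i j *: 1.
Proof.
move=> AT; rewrite mderiv_score_poly// mderiv_sum (bigD1 j)//= mpoly.mderivZ mderiv_var eqxx.
rewrite scale1r big1 ?addr0// => k kj.
by rewrite mpoly.mderivZ mderiv_var eq_sym (negbTE kj) scale0r scaler0.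
Qed.

Lemma gauss_mean_score A : A^T = A -> gauss_mean (score_poly A) = 0.
Proof.
move=> AT; rewrite -[score_poly A]mulr1 gauss_mean_scoreM.
rewrite big1 ?mulr0// => i _; rewrite big1// => j _.
by rewrite -mpoly.mpolyC1 mpoly.mderivC raddf0 gauss_mean0 mulr0.
Qed.

Lemma mxtrace_mul_trE A B : \tr (A *m B^T) = \sum_i \sum_j A i j * B i j.
Proof. by apply: eq_bigr => i _; rewrite mxE; apply: eq_bigr => j _; rewrite mxE. Qed.

Lemma gauss_mean_score2 A B : A^T = A -> B^T = B ->
  gauss_mean (score_poly A * score_poly B) = \tr (A *m B) / 2.
Proof.
move=> AT BT; rewrite gauss_mean_scoreM mulrC -{2}BT mxtrace_mul_trE; congr (_ / _).
apply: eq_bigr => i _; apply: eq_bigr => j _.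
by rewrite mderiv2_score_poly// gauss_meanZ gauss_mean1 mulr1.
Qed.

Lemma gauss_mean_linear_forms (u v : 'I_n -> R) :
  gauss_mean ((\sum_k u k *: X k) * (\sum_k v k *: X k)) = \sum_k u k * v k.
Proof.
rewrite mulr_suml gauss_mean_sum; apply: eq_bigr => k _.
rewrite -scalerAl gauss_meanZ gauss_mean_stein mderiv_sum gauss_mean_sum; congr (_ * _).
rewrite (bigD1 k)//= big1 ?addr0 => [|l lk]; rewrite mpoly.mderivZ mderiv_var !gauss_meanZ.
  by rewrite eqxx gauss_mean1 !mulr1.
by rewrite eq_sym (negbTE lk) mul0r mulr0.
Qed.

Lemma gauss_mean_score3 A B C : A^T = A -> B^T = B -> C^T = C ->
  gauss_mean (score_poly A * (score_poly B * score_poly C)) = \tr (A *m B *m C).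
Proof.
move=> AT BT CT; rewrite gauss_mean_scoreM.
have E i j : gauss_mean (D j (D i (score_poly B * score_poly C))) =
    (B *m C) i j + (B *m C)^T i j.
  rewrite mpoly.mderivM raddfD /= !mpoly.mderivM !mderiv2_score_poly//.
  rewrite mulr_algl mulr_algr !gauss_meanD !mderiv_score_poly//.
  (* In the Leibniz expansion, the terms with an undifferentiated score have mean 0; the two mixed
     terms, products of linear forms, give [B C] and its transpose. *)
  rewrite !(gauss_meanZ _ (score_poly _)) !gauss_mean_score// !mulr0.
  rewrite add0r addr0 !gauss_mean_linear_forms.
  rewrite !mxE; congr (_ + _); apply: eq_bigr => k _.
    by congr (_ * _); rewrite -{1}CT mxE.
  by congr (_ * _); rewrite -{1}CT mxE.
under eq_bigr do under eq_bigr do rewrite E mulrDr.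
under eq_bigr do rewrite big_split.
rewrite big_split /= -!mxtrace_mul_trE trmxK trmx_mul BT CT.
have -> : \tr (A *m (C *m B)) = \tr (A *m (B *m C)).
  by rewrite -mxtrace_tr !trmx_mul AT BT CT mxtrace_mulC.
by rewrite mulmxA -mulr2n -[T in _ * T]mulr_natl mulKf// pnatr_eq0.
Qed.

End GaussianScores.

Section NormalExpectation.
Context {R : realType} {n : nat}.
Local Notation Rn := (n.-tuple (measurableTypeR R)).
Local Notation Sym := (Sym R n).
Local Notation U := (@SymPos R n).

Lemma Rintegral_mulv_trig (L : 'M[R]_n) (F : Rn -> R) :
  is_trig_mx L -> (forall i, 0 < L i i) ->
  (lebesgue_Rn n).-integrable setT (EFin \o F) ->
  \int[lebesgue_Rn n]_z F z = \int[lebesgue_Rn n]_z (\det L * F (mulv L^T z)).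
Proof.
move=> Lt Ld iF; have mF := measurable_int _ iF.
have dL : 0 < \det L by rewrite det_trig// prodr_gt0.
have E f (f0 : forall z, (0 <= f z)%E) : measurable_fun setT f ->
    (\int[lebesgue_Rn n]_z f z = \int[lebesgue_Rn n]_z ((\det L)%:E * f (mulv L^T z)))%E.
  move=> mf; rewrite (ge0_integral_mulv_trig Lt Ld)// ge0_integralZl//; last 1 first.
  - by rewrite lee_fin ltW.
  by apply: measurableT_comp => //; exact: measurable_mulv.
rewrite /Rintegral; congr fine; rewrite integralE [RHS]integralE.
rewrite (E (EFin \o F)^\+%E)//; last exact: measurable_funepos.
rewrite (E (EFin \o F)^\-%E)//; last exact: measurable_funeneg.
congr (_ - _)%E; apply: eq_integral => z _.
  by rewrite !funeposE /= EFinM maxe_pMr ?mule0// lee_fin ltW.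
by rewrite !funenegE /= -mulrN EFinM maxe_pMr ?mule0// lee_fin ltW.
Qed.

Lemma SymPos_invmx_cholesky (S : Sym) : U S ->
  exists L : 'M[R]_n, [/\ is_trig_mx L, forall i, 0 < L i i & invmx S = L *m L^T].
Proof.
move=> US; have Su := SymPos_unitmx US.
apply: cholesky; first by rewrite trmx_inv sym_trmx.
move=> x x0; have y0 : invmx S *m x != 0.
  by apply: contra x0 => /eqP hx; rewrite -(mulKVmx Su x) hx mulmx0.
have := US _ y0; rewrite /= trmx_mul trmx_inv sym_trmx.
by rewrite -mulmxA mulKVmx// mulmxA.
Qed.

(** With [y = L^T x], the quadratic form is [|y|^2] and [\det S = (\det L)^-2]. The factor [\det L]
    is the Jacobian of the substitution, so it disappears from expectations. *)
Lemma normal0_pdf_std_gauss (S : Sym) (L : 'M[R]_n) (x : Rn) :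
  is_trig_mx L -> (forall i, 0 < L i i) -> U S -> invmx S = L *m L^T ->
  normal0_pdf S x = \det L * std_gauss (mulv L^T x).
Proof.
move=> Lt Ld US SL; have Su := SymPos_unitmx US.
have dL : 0 < \det L by rewrite det_trig// prodr_gt0.
have dS : \det S = (\det L)^-1 ^+ 2.
  by rewrite -[\det S]invrK -det_inv SL det_mulmx det_tr invfM expr2.
have pi0 : 0 <= 2 * pi :> R by rewrite mulr_ge0// pi_ge0.
rewrite /normal0_pdf detZ dS sqrtrM ?exprn_ge0// sqrtr_sqr gtr0_norm ?invr_gt0//.
rewrite invfM invrK [_ * \det L]mulrC -mulrA; congr (_ * _).
rewrite /std_gauss /gauss big_split /= -expR_sum; congr (_ * expR _).
  rewrite prodr_const card_ord exprVn; congr (_^-1).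
  by elim: (n) => [|k IH]; rewrite ?expr0 ?sqrtr1// !exprS sqrtrM// IH.
rewrite SL -mulr_suml sumrN; congr (- _ / _).
rewrite !mulmxA -mulmxA -[_ *m L]trmxK trmx_mul trmxK mulmx_tr_colE.
by apply: eq_bigr => i _; rewrite tnth_mktuple expr2.
Qed.

Lemma expectation0_peval (S : Sym) (L : 'M[R]_n) (f : Rn -> R) p :
  is_trig_mx L -> (forall i, 0 < L i i) -> U S -> invmx S = L *m L^T ->
  (forall x, f x = peval p (mulv L^T x)) -> expectation0 S f = gauss_mean p.
Proof.
move=> Lt Ld US SL fp; rewrite /gauss_mean (Rintegral_mulv_trig Lt Ld); last first.
  exact: integrable_peval.
congr fine; apply: eq_integral => x _.
by rewrite (normal0_pdf_std_gauss x Lt Ld US SL) fp mulrCA.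
Qed.

End NormalExpectation.

(** * The score and the Fisher metric *)

Section Score.
Context {R : realType} {n : nat}.
Local Notation Rn := (n.-tuple (measurableTypeR R)).
Local Notation Sym := (Sym R n).
Local Notation U := (@SymPos R n).

(* In the coordinates [P^T x] the line [S + t X] is the diagonal matrix with
   entries [1 + t d_i], so that the log-density along it is an explicit sum. *)
Lemma sym_simultaneous_diag (S X : Sym) : U S -> exists (P : 'M[R]_n) (d : 'rV[R]_n),
  [/\ P \in unitmx, invmx S = P *m P^T & (X : 'M[R]_n) = (invmx P)^T *m diag_mx d *m invmx P].
Proof.
move=> US; have Su := SymPos_unitmx US.
have [L [Lt Ld SL]] := SymPos_invmx_cholesky US.
have Lu := trig_posdiag_unitmx Lt Ld.
have /symmetric_orthogonal_diag[Q [QQ /is_diag_mxP dQ]] : (L^T *m X *m L)^T = L^T *m X *m L.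
  by rewrite !trmx_mul trmxK sym_trmx mulmxA.
have [Qu _] := mulmx1_unit QQ.
have QE : Q^T = invmx Q by rewrite -[Q^T](mulKmx Qu) QQ mulmx1.
pose d := \row_i (Q *m (L^T *m X *m L) *m Q^T) i i.
have dE : Q *m (L^T *m X *m L) *m Q^T = diag_mx d.
  apply/matrixP => i j; rewrite [RHS]mxE; case: eqVneq => [->|ij].
    by rewrite mulr1n [RHS]mxE.
  by rewrite mulr0n dQ.
exists (L *m Q^T), d; split.
- by rewrite unitmx_mul Lu unitmx_tr.
- by rewrite trmx_mul trmxK -mulmxA QE (mulKmx Qu).
have Pu : (L *m Q^T)^T \in unitmx by rewrite unitmx_tr unitmx_mul Lu unitmx_tr.
have -> : diag_mx d = (L *m Q^T)^T *m X *m (L *m Q^T) by rewrite -dE trmx_mul trmxK !mulmxA.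
move: (L *m Q^T) Pu => P Pu; rewrite trmx_inv -!mulmxA.
by rewrite mulmxV ?mulmx1 ?(mulKmx Pu)// -unitmx_tr.
Qed.

Lemma ln_prod (I : Type) (r : seq I) (P : pred I) (f : I -> R) :
  (forall i, P i -> 0 < f i) ->
  ln (\prod_(i <- r | P i) f i) = \sum_(i <- r | P i) ln (f i).
Proof.
move=> f0; rewrite -[RHS]expRK expR_sum; congr ln; apply: eq_bigr => i Pi.
by rewrite lnK// posrE f0.
Qed.

Lemma derive_line (V W : normedModType R) (f : V -> W) (p v : V) :
  'D_v f p = 'D_1 (fun t : R => f (t *: v + p)) 0.
Proof.
rewrite /derive; apply: (congr1 (fun h : R -> W => lim (h @ 0^'))); apply/funext => t /=.
by rewrite addr0 scale0r add0r [t *: 1]mulr1.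
Qed.

Lemma is_derive_sum_fun (m : nat) (h : 'I_m -> R -> R) (x : R) (dh : 'I_m -> R) :
  (forall i, is_derive x 1 (h i) (dh i)) ->
  is_derive x 1 (fun t => \sum_i h i t) (\sum_i dh i).
Proof.
move=> H; have -> : (fun t => \sum_i h i t) = \sum_i h i.
  by apply/funext => t; rewrite fct_sumE.
exact: is_derive_sum. Qed.

(** One summand of minus the log-density along the line [S + t X], where [a] is the eigenvalue [d_i]
    and [b] the square of the coordinate [(P^T x)_i]. *)
Lemma is_derive_score (a b : R) :
  is_derive (0 : R) 1 (fun t : R => (ln (1 + t * a) + b / (1 + t * a)) / 2) ((a - a * b) / 2).
Proof.
have d1 : is_derive (0 : R) 1 (fun t : R => 1 + t * a) a.
  have -> : (fun t : R => 1 + t * a) = cst 1 + a *: id.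
    by apply/funext => t; rewrite fctE /GRing.scale /= mulrC.
  apply: is_derive_eq (is_deriveD (is_derive_cst _ _ _) (is_deriveZ _ (is_derive_id _ _))) _.
  by rewrite /GRing.scale /= add0r mulr1.
have d10 : 1 + 0 * a = 1 by rewrite mul0r addr0.
have dl : is_derive (0 : R) 1 (fun t : R => ln (1 + t * a)) a.
  have l1 : is_derive (1 + 0 * a) 1 (@ln R) 1.
    by rewrite d10 -[in X in is_derive _ _ _ X]invr1; exact: is_derive1_ln.
  have dc := is_derive1_comp (g := fun t : R => 1 + t * a) l1 d1.
  by rewrite mul1r in dc.
have di : is_derive (0 : R) 1 (fun t : R => (1 + t * a)^-1) (- a).
  apply: is_derive_eq (is_deriveV _ d1) _; first by rewrite d10 oner_eq0.
  by rewrite /GRing.scale /= d10 expr1n invr1 mulN1r.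
have -> : (fun t : R => (ln (1 + t * a) + b / (1 + t * a)) / 2) =
    2^-1 *: ((fun t : R => ln (1 + t * a)) + b *: (fun t : R => (1 + t * a)^-1)).
  by apply/funext => t; rewrite !fctE /GRing.scale /= mulrC.
apply: is_derive_eq (is_deriveZ _ (is_deriveD dl (is_deriveZ _ di))) _.
by rewrite /GRing.scale /=; ring.
Qed.

Lemma log_density_diag (S : Sym) (P : 'M[R]_n) (d : 'rV[R]_n) (x : Rn) :
  P \in unitmx -> (S : 'M[R]_n) = (invmx P)^T *m diag_mx d *m invmx P -> (forall i, 0 < d 0 i) ->
  log_density x S = - (ln ((2 * pi) ^+ n * (\det P)^-1 ^+ 2) / 2) -
    \sum_i (ln (d 0 i) + (P^T *m vec x) i 0 ^+ 2 / d 0 i) / 2.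
Proof.
move=> Pu SE d0.
have dP : \det P != 0 by rewrite -unitfE -unitmxE.
have pi0 : 0 < 2 * pi :> R by rewrite mulr_gt0// pi_gt0.
have du : diag_mx d \in unitmx.
  by rewrite unitmxE det_diag unitfE; apply/prodf_neq0 => i _; rewrite gt_eqF.
have c0 : 0 < (2 * pi) ^+ n * (\det P)^-1 ^+ 2.
  apply: mulr_gt0; first exact: exprn_gt0.
  by rewrite exprn_even_gt0//= invr_eq0.
have detE : \det ((2 * pi) *: (S : 'M[R]_n)) =
    (2 * pi) ^+ n * (\det P)^-1 ^+ 2 * \prod_i d 0 i.
  by rewrite detZ SE !det_mulmx det_tr det_diag det_inv; ring.
have det0 : 0 < \prod_i d 0 i by rewrite prodr_gt0.
have qE : ((vec x)^T *m invmx S *m vec x) 0 0 = \sum_i (P^T *m vec x) i 0 ^+ 2 / d 0 i.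
  have -> : invmx S = P *m diag_mx (\row_i (d 0 i)^-1) *m P^T.
    have SB : (S : 'M[R]_n) *m (P *m diag_mx (\row_i (d 0 i)^-1) *m P^T) = 1%:M.
      rewrite SE -!mulmxA (mulKmx Pu) [diag_mx d *m _]mulmxA mulmx_diag.
      rewrite [T in diag_mx T](_ : _ = const_mx 1); last first.
        by apply/rowP => i; rewrite !mxE mulfV// gt_eqF.
      by rewrite diag_const_mx mul1mx -trmx_mul mulmxV// trmx1.
    have [Su _] := mulmx1_unit SB.
    by rewrite -[RHS](mulKmx Su) SB mulmx1.
  rewrite !mulmxA -mulmxA -[_ *m P]trmxK trmx_mul trmxK.
  rewrite mul_mx_diag mxE; apply: eq_bigr => i _; rewrite !mxE; ring.
rewrite /log_density /normal0_pdf qE detE.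
have s0 : 0 < Num.sqrt ((2 * pi) ^+ n * (\det P)^-1 ^+ 2 * \prod_i d 0 i).
  by rewrite sqrtr_gt0 mulr_gt0.
rewrite [LHS]lnM ?posrE ?expR_gt0 ?invr_gt0// expRK lnV//.
have lns (u : R) : 0 < u -> ln (Num.sqrt u) = ln u / 2.
  move=> u0; rewrite -{2}(sqr_sqrtr (ltW u0)) lnXn ?sqrtr_gt0//.
  by rewrite -[_ *+ 2]mulr_natr mulfK// pnatr_eq0.
rewrite lns; last exact: mulr_gt0.
rewrite [T in - (T / 2) + _]lnM ?posrE// ln_prod// -mulr_suml big_split /=; ring.
Qed.

Lemma derive_log_density (S X : Sym) (x : Rn) : U S ->
  'D_X (log_density x) S =
  ((vec x)^T *m (invmx S *m X *m invmx S) *m vec x) 0 0 / 2 - tr1 S X / 2.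
Proof.
move=> US; have [P [d [Pu SP XE]]] := sym_simultaneous_diag X US.
have SB : (S : 'M[R]_n) = (invmx P)^T *m invmx P.
  have Ptu : P^T \in unitmx by rewrite unitmx_tr.
  rewrite trmx_inv -[LHS](mulmxK Pu); congr (_ *m _).
  by rewrite -[LHS](mulmxK Ptu) -[S *m P *m _]mulmxA -SP mulmxV ?mul1mx// SymPos_unitmx.
have SE t : (t *: X + S : Sym) =
    (invmx P)^T *m diag_mx (\row_i (1 + t * d 0 i)) *m invmx P :> 'M[R]_n.
  rewrite [LHS]/= XE SB -[T in _ + T *m _]mulmx1 scalemxAl scalemxAr -mulmxDl -mulmxDr.
  congr (_ *m _ *m _); apply/matrixP => i j.
  by rewrite !mxE; case: eqVneq => _; rewrite ?mulr1n ?mulr0n ?mulr0 ?addr0// addrC.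
(* Finitely many open conditions, true at [t = 0]: near 0 the line stays where [log_density_diag]
   applies, which suffices for the derivative. *)
have near1 : \forall t \near (0 : R), forall i, 0 < 1 + t * d 0 i.
  suff H (i : 'I_n) : nbhs (0 : R) [set t : R | 0 < 1 + t * d 0 i].
    exact: (@filter_forall R 'I_n (fun i => [set t : R | 0 < 1 + t * d 0 i]) (nbhs (0 : R))).
  have c1 : (fun t : R => 1 + t * d 0 i) @ (0 : R) --> 1 + 0 * d 0 i.
    by apply: cvgD; [exact: cvg_cst | apply: cvgMl; exact: cvg_id].
  rewrite mul0r addr0 in c1.
  exact: (cvgr_gt _ c1 _ ltr01).
pose c := - (ln ((2 * pi) ^+ n * (\det P)^-1 ^+ 2) / 2).
have nE : \forall t \near (0 : R), c -
    \sum_i (ln (1 + t * d 0 i) + (P^T *m vec x) i 0 ^+ 2 / (1 + t * d 0 i)) / 2 =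
    log_density x (t *: X + S).
  apply: filterS near1 => t t1.
  rewrite (log_density_diag x Pu (SE t)) => [|i]; last by rewrite mxE.
  by congr (_ - _); apply: eq_bigr => i _; rewrite !mxE.
have ds : is_derive (0 : R) 1 (fun t : R => c -
    \sum_i (ln (1 + t * d 0 i) + (P^T *m vec x) i 0 ^+ 2 / (1 + t * d 0 i)) / 2)
    (0 - \sum_i (d 0 i - d 0 i * (P^T *m vec x) i 0 ^+ 2) / 2).
  apply: is_deriveB; apply: is_derive_sum_fun => i; exact: is_derive_score.
rewrite derive_line (@derive_val _ _ _ _ _ _ _ (near_eq_is_derive nE ds)).
have SX : invmx S *m X = P *m diag_mx d *m invmx P.
  rewrite SP XE trmx_inv -!mulmxA; congr (_ *m _).
  by rewrite mulKVmx// unitmx_tr.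
have -> : ((vec x)^T *m (invmx S *m X *m invmx S) *m vec x) 0 0 =
    \sum_i d 0 i * (P^T *m vec x) i 0 ^+ 2.
  have -> : invmx S *m X *m invmx S = P *m diag_mx d *m P^T.
    by rewrite SX SP -!mulmxA (mulKmx Pu).
  rewrite !mulmxA -mulmxA -[_ *m P]trmxK trmx_mul trmxK.
  rewrite mul_mx_diag mxE; apply: eq_bigr => i _; rewrite !mxE; ring.
have -> : tr1 S X = \sum_i d 0 i.
  by rewrite /tr1 SX mxtrace_mulC mulmxA mulVmx// mul1mx mxtrace_diag.
rewrite -mulr_suml sumrB; ring.
Qed.

End Score.

Section FisherMetric.
Context {R : realType} {n : nat}.
Local Notation Rn := (n.-tuple (measurableTypeR R)).
Local Notation Sym := (Sym R n).
Local Notation U := (@SymPos R n).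

Lemma derive_log_density_score (S X : Sym) (L : 'M[R]_n) (x : Rn) :
  U S -> invmx S = L *m L^T ->
  'D_X (log_density x) S = peval (score_poly (L^T *m X *m L)) (mulv L^T x).
Proof.
move=> US SL; rewrite derive_log_density// peval_score_poly vec_mulv /tr1 SL.
rewrite [in RHS]mxtrace_mulC trmx_mul trmxK; congr (_ / 2 - _ / 2).
  by rewrite !mulmxA.
by rewrite !mulmxA.
Qed.

Lemma mxtrace_congr2 (L A B : 'M[R]_n) :
  \tr (L^T *m A *m L *m (L^T *m B *m L)) = \tr (L *m L^T *m A *m (L *m L^T *m B)).
Proof. by rewrite !mulmxA [LHS]mxtrace_mulC !mulmxA. Qed.

Lemma fisher_metricE (S X Y : Sym) : U S -> fisher_metric S X Y = tr2 S X Y / 2.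
Proof.
move=> US; have [L [Lt Ld SL]] := SymPos_invmx_cholesky US.
have symL (W : Sym) : (L^T *m W *m L)^T = L^T *m W *m L.
  by rewrite !trmx_mul trmxK sym_trmx mulmxA.
pose s (W : Sym) := score_poly (L^T *m W *m L).
rewrite /fisher_metric (expectation0_peval (p := s X * s Y) Lt Ld US SL).
  by rewrite gauss_mean_score2// mxtrace_congr2 /tr2 SL.
by move=> x; rewrite !(derive_log_density_score _ _ US SL) /peval mpoly.mevalM.
Qed.

Lemma amari_chentsovE (a : R) : @amari_chentsov R n a = cubic 0 0 a.
Proof.
apply/funext => S; rewrite /amari_chentsov; case: (pselect (U S)) => US; last first.
  by rewrite cubic_out// patchN// notin_setE.
rewrite patchT ?inE// cubicE// /cubic_fun; apply/funext => X; apply/funext => Y; apply/funext => Z.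
have [L [Lt Ld SL]] := SymPos_invmx_cholesky US.
have symL (W : Sym) : (L^T *m W *m L)^T = L^T *m W *m L.
  by rewrite !trmx_mul trmxK sym_trmx mulmxA.
rewrite !mul0r !add0r; congr (_ * _).
pose s (W : Sym) := score_poly (L^T *m W *m L).
rewrite (expectation0_peval (p := s X * (s Y * s Z)) Lt Ld US SL).
  rewrite gauss_mean_score3// /tr3 SL.
  by rewrite !mulmxA [LHS]mxtrace_mulC !mulmxA.
by move=> x; rewrite !(derive_log_density_score _ _ US SL) /peval !mpoly.mevalM mulrA.
Qed.

Lemma fisher_riemannian_metric : riemannian_metric U (@fisher_metric R n).
Proof.
split=> [S US Y a X X'|S US X Y|S US X X0|X Y].
- by rewrite !fisher_metricE// tr2_scalar mulrDl mulrA.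
- by rewrite !fisher_metricE// tr2C.
- rewrite fisher_metricE// divr_gt0//.
  have [L [Lt Ld SL]] := SymPos_invmx_cholesky US.
  have Lu := trig_posdiag_unitmx Lt Ld.
  have Ltu : L^T \in unitmx by rewrite unitmx_tr.
  have AT : (L^T *m X *m L)^T = L^T *m X *m L by rewrite !trmx_mul trmxK sym_trmx mulmxA.
  (* The trace is the sum of the squared entries of the symmetric matrix [L^T X L], which vanishes
     only if [X] does. *)
  rewrite /tr2 SL -mxtrace_congr2 -{2}AT mxtrace_mul_trE pair_big /=.
  rewrite lt_def sumr_ge0 ?andbT => [|p _]; last by rewrite -expr2 sqr_ge0.
  apply: contra X0 => /eqP/psumr_eq0P A0; apply/eqP/val_inj => /=.
  rewrite -[LHS](mulKmx Ltu) -[T in _ *m T](mulmxK Lu); set A := L^T *m X *m L.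
  suff -> : A = 0 by rewrite mul0mx mulmx0.
  apply/matrixP => i j; apply/eqP; rewrite [T in _ == T]mxE -[_ == 0]orbb -mulf_eq0; apply/eqP.
  by apply: (A0 _ (i, j)) => // p _; rewrite -expr2 sqr_ge0.
apply: (smooth_on_eq (@SymPos_open R n) (f := fun S => tr2 S X Y * 2^-1)) => [S US|].
  by rewrite fisher_metricE.
apply: smooth_onM; [exact: SymPos_open|exact: smooth_tr2|].
exact: smooth_on_cst.
Qed.

Lemma fisher_G_invariant2 : G_invariant2 (@fisher_metric R n).
Proof.
move=> h hu S US X Y; rewrite !diff_sym_linear !fisher_metricE//; last exact: act_SymPos.
by rewrite tr2_act.
Qed.

End FisherMetric.

Theorem theorem1p2 (R : realType) (n : nat) (n_ge1 : (1 <= n)%N) :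
  [/\ (forall (g : Sym R n -> Sym R n -> Sym R n -> R)
          (C : Sym R n -> Sym R n -> Sym R n -> Sym R n -> R),
          statistical_structure (@SymPos R n) g C ->
          G_invariant2 g -> G_invariant3 C ->
          conjugate_symmetric (@SymPos R n) g C) /\
      S3_CS_G (@fisher_metric R n) = @S3_G R n,
      exists Phi : (Sym R n -> Sym R n -> Sym R n -> Sym R n -> R) ->
                   mpoly.mpoly n R,
        linear_isomorphism (@S3_G R n) (@SP3 R n) Phi /\
        forall alpha : R,
          @S3_G R n (@amari_chentsov R n alpha) /\
          Phi (@amari_chentsov R n alpha) =
          alpha *: \sum_(i < n) mpoly.mpolyX R (mpoly.mnm1 i) ^+ 3
    & has_dimension (S3_CS_G (@fisher_metric R n))
        (if (3 <= n)%N then 3 else if n == 2 then 2 else 1)%N].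
Proof.
have E : S3_CS_G (@fisher_metric R n) = @S3_G R n.
  exact: S3_CS_GE fisher_riemannian_metric fisher_G_invariant2.
split.
- by split=> // g C; exact: invariant_conjugate_symmetric.
- exists cubic_symbol; split; first exact: cubic_symbol_iso.
  move=> a; rewrite amari_chentsovE; split; first exact: cubic_S3_G.
  exact: cubic_symbol_tr3.
by rewrite E; exact: S3_G_dimension.
Qed.
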